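(* Assume $\mathsf{IIA}$. Then: (1) the product of at most countably many separable Fréchet topological groups is Fréchet; and (2) the product of finitely many countable sequential topological groups, each of which is either discrete or not Fréchet, is sequential.
   Context: All topological spaces and groups are $T_1$ and completely regular. A sequence converging to $x$ is identified with an infinite set $C$ such that $C\setminus U$ is finite for every neighborhood $U$ of $x$ (written $C\to x$). $A\subseteq^* B$ means $A\setminus B$ is finite. A space $X$ is Fréchet if whenever $x\in\overline A\subseteq X$ there is a sequence of points of $A$ converging to $x$ (here constant sequences are allowed). A space $X$ is sequential if for every non-closed $A\subseteq X$ there is a sequence $C\subseteq A$ with $C\to x$ for some $x\notin A$. An ideal on a set $X$ is a family of subsets of $X$ closed under subsets and finite unions; ideals are assumed to contain all finite sets (this convention does not apply to the ideals $\mathcal I_x$ defined below). $\mathcal I^+=\mathcal P(X)\setminus\mathcal I$. An ideal $\mathcal I$ on a group $\mathbb G$ is invariant if $g\cdot I$, $I\cdot g$ and $I^{-1}$ are in $\mathcal I$ for all $I\in\mathcal I$, $g\in\mathbb G$. An ideal $\mathcal I$ on $X$ is $\omega$-hitting if for every countable family $\mathcal Y$ of infinite subsets of $X$ there is $I\in\mathcal I$ with $Y\cap I$ infinite for every $Y\in\mathcal Y$. An ideal $\mathcal I$ is tame if for every $Y\in\mathcal I^+$, every $f:Y\to\omega$ and every $\omega$-hitting ideal $\mathcal J$ on $\omega$ there is $J\in\mathcal J$ with $f^{-1}[J]\notin\mathcal I$. An ideal $\mathcal I$ on a topological group $\mathbb G$ is weakly closed if for every $A\subseteq\mathbb G$ and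 every (infinite) sequence $C\subseteq\mathbb G$ converging to $1_{\mathbb G}$: $A\in\mathcal I$ if and only if $A\cup\{x: C\cdot x\subseteq^* A\}\in\mathcal I$. For a point $x$ of a space $X$ let $\mathcal I_x=\{A\subseteq X: x\notin\overline A\}$. A set $Y\subseteq X$ is entangled if $\mathcal I_x\restriction Y=\{A\subseteq Y:x\notin\overline A\}$ is $\omega$-hitting (on $Y$) for every $x\in X$. A space is groomed if it does not contain a dense entangled set. $\mathsf{IIA}$ (the Invariant Ideal Axiom) is the statement: for every countable groomed topological group $\mathbb G$ and every tame, weakly closed, invariant ideal $\mathcal I\subseteq\mathcal P(\mathbb G)$ one of the following holds: (1) there is a countable $\mathcal S\subseteq\mathcal I$ such that for every infinite sequence $C$ convergent in $\mathbb G$ there is $I\in\mathcal S$ with $C\cap I$ infinite; (2) there is a countable $\mathcal H\subseteq\mathcal I^+$ such that for every non-empty open $U\subseteq\mathbb G$ there is $H\in\mathcal H$ with $H\setminus U\in\mathcal I$. *)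

(* Defs.v *)
From HB Require Import structures.
From mathcomp Require Import all_boot all_order all_algebra.
From mathcomp Require Import all_classical all_reals topology normedtype.

Set Implicit Arguments.
Unset Strict Implicit.
Unset Printing Implicit Defensive.

Local Open Scope classical_set_scope.

HB.structure Definition PreTopologicalGroup :=
  {G of Topological G & Group G}.

HB.mixin Record PreTopologicalGroup_isTopologicalGroup G
    & PreTopologicalGroup G := {
  mulg_continuous : continuous (fun p : G * G => (p.1 * p.2)%g) ;
  invg_continuous : continuous (fun x : G => (x^-1)%g) ;
}.

#[short(type="topologicalGroupType")]
HB.structure Definition TopologicalGroup :=
  {G of PreTopologicalGroup G & PreTopologicalGroup_isTopologicalGroup G}.

Section Spaces.
Variable X : topologicalType.

Definition t1_completely_regular : Prop :=
  accessible_space X /\ completely_regular_space X.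

(* A convergent sequence, identified with its (infinite) range. Nothing asks
   for [C] to be countable: every countably infinite subset of [C] converges
   to [x] as well. *)
Definition seq_converges_to (C : set X) (x : X) : Prop :=
  infinite_set C /\ forall U, nbhs x U -> finite_set (C `\` U).

(* Constant sequences are allowed here, hence maps [nat -> X] rather than
   [seq_converges_to]. *)
Definition frechet_space : Prop :=
  forall (A : set X) (x : X), closure A x ->
    exists u : nat -> X, (forall n, A (u n)) /\ u @ \oo --> x.

Definition sequential_space : Prop :=
  forall A : set X, ~ closed A ->
    exists (C : set X) (x : X), [/\ C `<=` A, seq_converges_to C x & ~ A x].

Definition separable_space : Prop :=
  exists D : set X, countable D /\ dense D.

Definition discrete_space : Prop := @nbhs X X = principal_filter.

End Spaces.

Section Ideals.
Variable T : Type.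

Definition is_ideal (I : set (set T)) : Prop :=
  [/\ forall A B : set T, A `<=` B -> I B -> I A,
      forall A B : set T, I A -> I B -> I (A `|` B)
    & forall A : set T, finite_set A -> I A].

(* [I] is a family of subsets of [X]; it is not required to satisfy [is_ideal],
   since the trace on [X] of the sets whose closure misses a given point need
   not contain all finite sets. *)
Definition omega_hitting (X : set T) (I : set (set T)) : Prop :=
  forall F : set (set T), countable F ->
    (forall Y, F Y -> Y `<=` X /\ infinite_set Y) ->
    exists2 A, I A & forall Y, F Y -> infinite_set (Y `&` A).

End Ideals.

(* A function [Y -> nat] is the restriction to [Y] of a total function [f];
   the preimage of [J] under it is [Y `&` f @^-1` J]. *)
Definition tame (T : Type) (I : set (set T)) : Prop :=
  forall Y : set T, ~ I Y -> forall (f : T -> nat) (J : set (set nat)),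
    is_ideal J -> omega_hitting setT J ->
    exists2 B, J B & ~ I (Y `&` f @^-1` B).

Definition entangled (X : topologicalType) (Y : set X) : Prop :=
  forall x : X, omega_hitting Y [set A | A `<=` Y /\ ~ closure A x].

Definition groomed (X : topologicalType) : Prop :=
  ~ exists Y : set X, dense Y /\ entangled Y.

Definition invariant_ideal (G : groupType) (I : set (set G)) : Prop :=
  forall A : set G, I A ->
    [/\ forall g : G, I [set (g * x)%g | x in A],
        forall g : G, I [set (x * g)%g | x in A]
      & I [set (x^-1)%g | x in A]].

Definition weakly_closed (G : topologicalGroupType) (I : set (set G)) : Prop :=
  forall A C : set G, seq_converges_to C 1%g ->
    (I A <->
     I (A `|` [set x | finite_set ([set (c * x)%g | c in C] `\` A)])).

Definition IIA : Prop :=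
  forall G : topologicalGroupType, t1_completely_regular G ->
  countable [set: G] -> groomed G ->
  forall I : set (set G),
  is_ideal I -> tame I -> weakly_closed I -> invariant_ideal I ->
  (exists S : set (set G),
     [/\ countable S, S `<=` I
       & forall (C : set G) (x : G), seq_converges_to C x ->
           exists2 A, S A & infinite_set (C `&` A)])
  \/
  (exists H : set (set G),
     [/\ countable H, H `<=` ~` I
       & forall U : set G, open U -> U !=set0 ->
           exists2 A, H A & I (A `\` U)]).

(* Main.v *)
(** In both parts IIA is applied to ideals for which one of its two alternatives
    is absurd.

    For (1), pass to a countable dense subgroup and take the nowhere dense sets.
    In a non-discrete Frechet group, if a decreasing sequence of sets A_n
    accumulates at a point, then some sequence picked from A_(n_i) with n_i
    tending to infinity converges to it; this makes the ideal tame and excludes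
    the first alternative. The second one yields a countable base at 1, so that
    all the groups are first countable.

    For (2), a sequential group that is not Frechet contains columns gamma_k
    converging to 1 such that 1 is not in the closure of any union of finite
    parts of the columns. Conjugating these columns by all elements of the
    group, each one infinitely often, gives operators D_k (points reached from a
    set through k successive columns), and the sets all of whose translates A
    and A^-1 have D_k empty for some k form an ideal for which the second
    alternative contradicts the property of gamma. Hence countably many sets
    N_m, with some D_(r_m) N_m empty, catch all convergent sequences. Next take
    the ideal of sets without infinite locally finite sequences. Under the
    second alternative, multiplying countably many locally finite sequences by
    products along r_m columns would give a set that almost misses every N_m,
    hence contains no sequence converging outside it, yet accumulates at 1.
    So convergent sequences are caught by countably many sequentially compact
    sets K_m, and in a finite product a neighbourhood avoiding a given
    sequentially closed set is an increasing union of boxes F_n inside the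
    boxes K_n. *)
Require Import Defs.
From HB Require Import structures.
From mathcomp Require Import all_boot all_order all_algebra.
From mathcomp Require Import all_classical all_reals topology normedtype.

Set Implicit Arguments.
Unset Strict Implicit.
Unset Printing Implicit Defensive.

Local Open Scope classical_set_scope.

(** * Frequently occurring values and enumerations *)

Definition often (P : nat -> Prop) := forall N, exists2 n, N <= n & P n.

Lemma not_often (P : nat -> Prop) :
  ~ often P -> exists N, forall n, N <= n -> ~ P n.
Proof.
by move=> /existsNP[N nN]; exists N => n Nn Pn; apply: nN; exists n.
Qed.

Lemma often_not (P : nat -> Prop) :
  ~ (exists N, forall n, N <= n -> P n) -> often (fun n => ~ P n).
Proof.
move=> nP N; apply: contrapT => nn; apply: nP; exists N => n Nn.
by apply: contrapT => nPn; apply: nn; exists n.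
Qed.

Lemma often_and (P Q : nat -> Prop) N : often P ->
  (forall n, N <= n -> Q n) -> often (fun n => P n /\ Q n).
Proof.
move=> oP NQ M; have [n] := oP (maxn N M).
by rewrite geq_max => /andP[/NQ Qn Mn] Pn; exists n.
Qed.

Lemma sub_often (P Q : nat -> Prop) : (forall n, P n -> Q n) ->
  often P -> often Q.
Proof. by move=> PQ oP N; have [n Nn /PQ] := oP N; exists n. Qed.

Lemma often_or (P Q : nat -> Prop) :
  often (fun n => P n \/ Q n) -> often P \/ often Q.
Proof.
move=> PQ; have [|/not_often[N NP]] := pselect (often P); first by left.
right; apply: sub_often (often_and PQ NP) => n [[]//].
Qed.

Lemma often_subseq (P : nat -> Prop) : often P ->
  exists nu : nat -> nat, (forall k, k <= nu k) /\ (forall k, P (nu k)).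
Proof.
move=> H; have /choice[nu nuP] : forall k, exists n, k <= n /\ P n.
  by move=> k; have [n kn Pn] := H k; exists n.
by exists nu; split=> k; have [] := nuP k.
Qed.

Lemma finite_bound (T : Type) (A : set T) (b : T -> nat) :
  finite_set A -> exists N, forall a, A a -> b a <= N.
Proof.
move=> /(finite_image b)/finite_seqP[s sE]; exists (\max_(i <- s) i) => a Aa.
have : (b @` A) (b a) by exists a.
by rewrite sE /= => bs; exact: (@leq_bigmax_seq _ s xpredT (fun i => i)).
Qed.

Lemma infinite_natP (A : set nat) : infinite_set A <-> often A.
Proof.
split=> [Ainf N|AN /(finite_bound id)[N NA]].
  apply: contrapT => nA; apply: Ainf; apply: (@sub_finite_set _ _ `I_N).
    move=> n An /=; rewrite ltnNge; apply/negP => Nn; apply: nA.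
    by exists n.
  exact: finite_II.
by have [n Nn /NA] := AN N.+1; rewrite leqNgt Nn.
Qed.

Lemma often_finite (T : Type) (F : set T) (u : nat -> T) :
  finite_set F -> often (F \o u) ->
  exists2 a, F a & often (fun n => u n = a).
Proof.
move=> Ffin uF; apply: contrapT => nF.
have /choice[b bP] : forall a, exists N, F a -> forall n, N <= n -> u n <> a.
  move=> a; have [Fa|] := pselect (F a); last by exists 0.
  have /not_often[N NP] : ~ often (fun n => u n = a).
    by move=> oa; apply: nF; exists a.
  by exists N.
have [N Nb] := finite_bound b Ffin; have [n Nn Fn] := uF N.
by apply: (bP (u n) Fn n) => //; exact: leq_trans (Nb _ Fn) Nn.
Qed.

Lemma infinite_range_often (T : Type) (u : nat -> T) (A : set T) :
  infinite_set (range u `&` A) -> often (A \o u).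
Proof.
move=> ruA; apply: contrapT => /not_often[N NA]; apply: ruA.
apply: (@sub_finite_set _ _ (u @` `I_N)); last exact/finite_image/finite_II.
move=> _ [[n _ <-] Aun]; exists n => //=; rewrite ltnNge; apply/negP => /NA.
exact.
Qed.

Lemma countable_enum (T : Type) (A : set T) : countable A -> A !=set0 ->
  exists2 f : nat -> T, (forall n, A (f n)) & forall x, A x -> exists n, f n = x.
Proof.
move=> /countable_injP[g ginj] [a Aa].
have /choice[f fP] : forall n, exists x,
    A x /\ ((exists2 y, A y & g y = n) -> g x = n).
  move=> n; have [[y Ay gy]|ny] := pselect (exists2 y, A y & g y = n).
    by exists y.
  by exists a; split => // /ny.
exists f => [n|x Ax]; first by have [] := fP n.
exists (g x); have [Afx gfx] := fP (g x).
by apply: ginj; rewrite ?inE //; apply: gfx; exists x.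
Qed.

Lemma countable_enum_often (T : Type) (A : set T) : countable A -> A !=set0 ->
  exists2 f : nat -> T, (forall n, A (f n)) &
    forall x, A x -> often (fun n => f n = x).
Proof.
move=> cA A0; have [f fA fs] := countable_enum cA A0.
(* The 2-adic valuation takes every value infinitely often: it equals [n] at [2 ^ n] times any odd
   number. *)
exists (fun n => f (logn 2 n)) => // x /fs[n <-] N.
exists (2 ^ n * N.*2.+1).
  rewrite (@leq_trans N.*2.+1) ?leq_pmull ?expn_gt0//.
  by rewrite -addnn -addSn leq_addl.
by rewrite lognM ?expn_gt0// pfactorK// lognE dvdn2 /= odd_double /= addn0.
Qed.

(** If the range is finite, some value [a] recurs infinitely often and [[set a]] is in [J];
    otherwise a set of [J] meets the infinite range infinitely often. *)
Lemma hitting_sequence (J : set (set nat)) (r : nat -> nat) :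
  is_ideal J -> omega_hitting setT J -> exists2 B, J B & often (B \o r).
Proof.
move=> [_ _ Jfin] Jhit; have [rfin|rinf] := pselect (finite_set (range r)).
  have [|a _ ra] := @often_finite _ (range r) r rfin.
    by move=> N; exists N => //; exists N.
  exists [set a]; first exact/Jfin/finite_set1.
  exact: ra.
have [|B JB HB] := Jhit [set range r] (countable1 _); first by move=> _ ->.
by exists B => //; apply: infinite_range_often; apply: HB.
Qed.

(** * Convergent sequences in spaces and groups *)

Section Sequences.
Variable T : topologicalType.
Implicit Types (u : nat -> T) (x : T) (A : set T).

Definition tends u x := forall U, nbhs x U -> exists N, forall n, N <= n -> U (u n).

Definition seq_closed A := forall u x, (forall n, A (u n)) -> tends u x -> A x.

Lemma tendsP u x : tends u x <-> u @ \oo --> x.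
Proof.
split=> [ux U /ux[N NU]|ux U /ux[N _ NU]]; first by exists N.
by exists N => n; exact: NU.
Qed.

Lemma tends_subseq u x (nu : nat -> nat) :
  (forall k, k <= nu k) -> tends u x -> tends (u \o nu) x.
Proof.
move=> nuk ux U /ux[N NU]; exists N => n Nn; apply: NU.
exact: leq_trans (nuk n).
Qed.

Lemma tends_unbounded u x (nu : nat -> nat) :
  (forall N, exists M, forall k, M <= k -> N <= nu k) ->
  tends u x -> tends (u \o nu) x.
Proof.
move=> nuN ux U /ux[N NU]; have [M MN] := nuN N.
by exists M => n /MN; exact: NU.
Qed.

Lemma tends_cst x : tends (fun=> x) x.
Proof. by move=> U /nbhs_singleton; exists 0. Qed.

Lemma tends_often_closure u x A : tends u x -> often (A \o u) -> closure A x.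
Proof.
move=> ux oA U /ux[N NU]; have [n Nn An] := oA N.
by exists (u n); split => //; exact: NU.
Qed.

Lemma tends_closure u x A : tends u x -> (forall n, A (u n)) -> closure A x.
Proof. by move=> ux uA; apply: (tends_often_closure ux) => N; exists N. Qed.

Lemma seq_conv_tends (C : set T) x : seq_converges_to C x ->
  exists u, [/\ forall n, C (u n), forall n, u n <> x, injective u & tends u x].
Proof.
move=> [Cinf Cx].
have /infiniteP/card_leP/unsquash f : infinite_set (C `\ x).
  by apply: infinite_setD => //; exact: finite_set1.
pose u n := set_val (f (to_setT n)).
have uC n : (C `\ x) (u n) by exact: set_valP.
have uinj : injective u.
  move=> i j /val_inj/(@inj _ _ _ f) fij.
  by have /(congr1 set_val) : to_setT i = to_setT j by apply: fij; rewrite inE.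
exists u; split => //.
- by move=> n; have [] := uC n.
- by move=> n; have [] := uC n.
- move=> U /Cx CU.
  have : finite_set (u @^-1` (C `\` U)).
    by apply: finite_preimage => // i j _ _; exact: uinj.
  move=> /(finite_bound id)[N NU]; exists N.+1 => n Nn.
  apply: contrapT => nU; have /NU : (u @^-1` (C `\` U)) n.
    by split => //; have [] := uC n.
  by rewrite leqNgt Nn.
Qed.

Hypothesis acc : accessible_space T.

Lemma tends_finite u x (F : set T) :
  tends u x -> finite_set F -> often (F \o u) -> F x.
Proof.
move=> ux Ff /(tends_often_closure ux).
by move/accessible_finite_set_closed: acc => /(_ _ Ff); exact.
Qed.

Lemma tends_seq_conv u x : (forall n, u n <> x) -> tends u x ->
  seq_converges_to (range u) x.
Proof.
move=> nux ux; split=> [fu|U /ux[N NU]].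
  have [n _ ] := tends_finite ux fu (fun N => ex_intro2 _ _ N (leqnn _)
    (imageP u (I : setT N))).
  exact: nux.
apply: (@sub_finite_set _ _ (u @` `I_N)); last exact/finite_image/finite_II.
move=> _ [[n _ <-] nUn]; exists n => //=; rewrite ltnNge.
by apply/negP => /NU.
Qed.

Lemma nbhs_neq (x y : T) : x <> y -> nbhs x (fun z => z <> y).
Proof.
move=> /eqP xy; have [U [oU xU yU]] := acc xy.
apply: (@filterS _ _ _ U); last first.
  by apply: open_nbhs_nbhs; split => //; rewrite inE in xU.
by move=> z Uz zy; rewrite inE in yU; apply: yU; rewrite -zy.
Qed.

End Sequences.

Lemma sequential_closed (T : topologicalType) (A : set T) :
  sequential_space T -> seq_closed A -> closed A.
Proof.
move=> Tseq Acl; apply: contrapT => /Tseq[C [x [CA Cx nAx]]]; apply: nAx.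
have [u [uC _ _ ux]] := seq_conv_tends Cx.
by apply: (Acl u) => // n; exact/CA/uC.
Qed.

Section Regular.
Variable T : topologicalType.
Hypothesis Treg : t1_completely_regular T.

Lemma closed_nbhs (x : T) U : nbhs x U ->
  exists V, [/\ open V, V x & closure V `<=` U].
Proof.
case: Treg => _ creg; rewrite nbhsE => -[O [oO Ox] OU].
have [uT [E /= [Eent ExO sub]]] : uniform_separator [set x] (~` O).
  by apply: creg; [exact: open_closedC|exact].
pose UT := Uniform.Pack uT.
have nO : @nbhs UT UT x O.
  apply/(@nbhsP UT); exists E => //= y /xsectionP Exy.
  apply: contrapT => nOy.
  by have : (([set x] `*` ~` O) `&` E) (x, y) by []; rewrite ExO.
have [W Wx WO] := @uniform_regular UT x O nO.
have WxT : @nbhs T T x W by exact: sub.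
exists (@interior T W); split=> //; first exact: open_interior.
move=> y Wy; apply: OU; apply: WO => B By.
have [z [Wz Bz]] := Wy _ (sub _ _ By).
by exists z; split => //; exact: interior_subset.
Qed.

Lemma separate (x y : T) : x <> y ->
  exists O, [/\ open O, O y & nbhs x (~` O)].
Proof.
case: (Treg) => acc _ xy.
have [|V [oV Vy Vx]] := @closed_nbhs y (fun z => z <> x).
  by apply: (nbhs_neq acc); exact: nesym.
exists V; split => //.
apply: contrapT => nV; apply: (Vx x) => //.
move=> B Bx; apply: contrapT => VB; apply: nV.
apply: (filterS _ Bx) => z Bz Vz.
by apply: VB; exists z.
Qed.

End Regular.

Section Group.
Variable G : topologicalGroupType.
Local Open Scope group_scope.
Implicit Types (x y g : G) (A B : set G) (u v : nat -> G).

Lemma nbhs_mul x y U : nbhs (x * y) U ->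
  exists V W, [/\ nbhs x V, nbhs y W & forall a b, V a -> W b -> U (a * b)].
Proof.
move=> /(@mulg_continuous G (x, y))[[V W] /= [Vx Wy] VWU].
by exists V, W; split => // a b Va Wb; exact: (VWU (a, b)).
Qed.

Lemma nbhs_inv x U : nbhs x^-1 U -> nbhs x (fun z => U z^-1).
Proof. by move/(@invg_continuous G x). Qed.

Lemma nbhs_mulr x g U : nbhs (x * g) U -> nbhs x (fun z => U (z * g)).
Proof.
move=> /nbhs_mul[V [W [Vx Wg VW]]]; apply: (filterS _ Vx) => z Vz.
by apply: VW => //; exact: nbhs_singleton.
Qed.

Lemma nbhs_mull x g U : nbhs (g * x) U -> nbhs x (fun z => U (g * z)).
Proof.
move=> /nbhs_mul[V [W [Vx Wg VW]]]; apply: (filterS _ Wg) => z Vz.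
by apply: VW => //; exact: nbhs_singleton.
Qed.

Lemma tends_mul u v x y : tends u x -> tends v y ->
  tends (fun n => u n * v n) (x * y).
Proof.
move=> ux vy U /nbhs_mul[V [W [/ux[N NV] /vy[M MW] VW]]].
exists (maxn N M) => n; rewrite geq_max => /andP[Nn Mn].
by apply: VW; [exact: NV|exact: MW].
Qed.

Lemma tends_inv u x : tends u x -> tends (fun n => (u n)^-1) x^-1.
Proof. by move=> ux U /nbhs_inv/ux. Qed.

Lemma closure_mulr A x g : closure A (x * g) -> closure (fun z => A (z * g)) x.
Proof.
move=> Axg U Ux; have := @nbhs_mulr (x * g) g^-1 U; rewrite mulgK => /(_ Ux).
by move=> /Axg[y [Ay Uy]]; exists (y * g^-1); split; rewrite /= ?mulgVK.
Qed.

Lemma closure_mull A x g : closure A (g * x) -> closure (fun z => A (g * z)) x.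
Proof.
move=> Axg U Ux; have := @nbhs_mull (g * x) g^-1 U; rewrite mulKg => /(_ Ux).
by move=> /Axg[y [Ay Uy]]; exists (g^-1 * y); split; rewrite /= ?mulVKg.
Qed.

Lemma closure_inv A x : closure A x^-1 -> closure (fun z => A z^-1) x.
Proof.
move=> Ax U Ux; have := @nbhs_inv x^-1 U; rewrite invgK => /(_ Ux).
by move=> /Ax[y [Ay Uy]]; exists y^-1; split; rewrite /= ?invgK.
Qed.

Lemma closure_mulrE A x g : closure (fun z => A (z * g)) x -> closure A (x * g).
Proof.
move=> H; have := @closure_mulr (fun z => A (z * g)) (x * g) g^-1.
rewrite mulgK => /(_ H); apply: closure_subset => z.
by rewrite mulgVK.
Qed.

Lemma closure_mullE A x g : closure (fun z => A (g * z)) x -> closure A (g * x).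
Proof.
move=> H; have := @closure_mull (fun z => A (g * z)) (g * x) g^-1.
rewrite mulKg => /(_ H); apply: closure_subset => z.
by rewrite mulVKg.
Qed.

Lemma open_inv A : open A -> open (fun z => A z^-1).
Proof. by rewrite !openE => oA x Ax; apply: nbhs_inv; exact: oA. Qed.

(* Images under translations and inversion are preimages under the inverse maps. *)
Lemma invariant_preimage (I : set (set G)) :
  (forall A g, I A -> I (fun x => A (g * x))) ->
  (forall A g, I A -> I (fun x => A (x * g))) ->
  (forall A, I A -> I (fun x => A x^-1)) -> invariant_ideal I.
Proof.
move=> Il Ir Iv A IA; split=> [g|g|].
- have -> : [set g * x | x in A] = (fun x => A (g^-1 * x)); last exact: Il.
  apply/seteqP; split=> [_ [x Ax <-]|x Ax]; first by rewrite mulKg.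
  by exists (g^-1 * x) => //; rewrite mulVKg.
- have -> : [set x * g | x in A] = (fun x => A (x * g^-1)); last exact: Ir.
  apply/seteqP; split=> [_ [x Ax <-]|x Ax]; first by rewrite mulgK.
  by exists (x * g^-1) => //; rewrite mulgVK.
- have -> : [set x^-1 | x in A] = (fun x => A x^-1); last exact: Iv.
  apply/seteqP; split=> [_ [x Ax <-]|x Ax]; first by rewrite invgK.
  by exists x^-1 => //; rewrite invgK.
Qed.

(** As [C] converges to 1, the translate of [C] by [x] converges to [x]; hence a point [x] added in
    the definition of weak closedness lies in [closure A]. *)
Lemma closure_stable_weakly_closed (I : set (set G)) :
  (forall A B : set G, A `<=` B -> I B -> I A) ->
  (forall A, I A -> I (closure A)) -> weakly_closed I.
Proof.
move=> Isub Icl A C [Cinf C1]; split; last by apply: Isub; left.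
move=> /Icl; apply: Isub => x [|CxA]; first exact: subset_closure.
move=> U Ux; have /C1 CU : nbhs 1 (fun c => U (c * x)).
  by apply: nbhs_mulr; rewrite mul1g.
have CA : finite_set [set c | C c /\ ~ A (c * x)].
  apply: (@sub_finite_set _ _ ((fun z => z * x^-1) @`
    ([set c * x | c in C] `\` A))); last exact: finite_image.
  move=> c [Cc nA]; exists (c * x); rewrite ?mulgK//.
  by split => //; exists c.
apply: contrapT => nAU; apply: Cinf.
apply: (@sub_finite_set _ _ ((C `\` (fun c => U (c * x))) `|`
  [set c | C c /\ ~ A (c * x)])); last by rewrite finite_setU.
move=> c Cc /=; have [Uc|] := pselect (U (c * x)); last by left.
right; split => // Ac; apply: nAU.
by exists (c * x).
Qed.

Lemma nbhs1_symm U : nbhs (1 : G) U -> t1_completely_regular G ->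
  exists V, [/\ open V, V 1, forall x, V x -> V x^-1 &
    forall x y, closure V x -> closure V y -> U (x^-1 * y)].
Proof.
move=> U1 Greg; have [|A [B [A1 B1 AB]]] := @nbhs_mul 1 1 U; first by rewrite mul1g.
have [|W [oW W1 Wcl]] := @closed_nbhs _ Greg 1 (A `&` B); first exact: filterI.
pose V := W `&` (fun x => W x^-1).
have oV : open V by apply: openI => //; exact: open_inv.
exists V; split=> //; first by split; rewrite ?invg1.
  by move=> x [Wx Wx']; split; rewrite ?invgK.
move=> x y Vx Vy; apply: AB; last first.
  by apply: (Wcl y _).2; apply: closure_subset Vy => z [].
apply: (Wcl x^-1 _).1.
have : closure (fun z => V z^-1) x^-1 by apply: closure_inv; rewrite invgK.
by apply: closure_subset => z [_]; rewrite invgK.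
Qed.

End Group.

(** The form in which the axiom is applied three times. Finite unions make the catching family
    increasing; the other family is nonempty, since it serves the open set [setT], and can be
    enumerated. *)
Lemma IIA_closure : IIA -> forall G : topologicalGroupType,
  t1_completely_regular G -> countable [set: G] -> groomed G ->
  forall I : set (set G), is_ideal I -> tame I ->
  (forall A, I A -> I (closure A)) -> invariant_ideal I ->
  (exists N : nat -> set G, [/\ forall m, I (N m),
      forall m n, m <= n -> N m `<=` N n &
      forall u x, tends u x -> (forall n, u n <> x) ->
        exists m, often (N m \o u)]) \/
  (exists H : nat -> set G, (forall n, ~ I (H n)) /\
      forall U, open U -> U !=set0 -> exists n, I (H n `\` U)).
Proof.
move=> iia G Greg Gc Gg I Iid It Icl Iinv.
have [Isub IU Ifin] := Iid.
have [[S [Sc SI Scap]]|[H [Hc HI Hpi]]] :=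
  iia G Greg Gc Gg I Iid It (closure_stable_weakly_closed Isub Icl) Iinv.
- left; have [||f fS fsurj] := @countable_enum _ (S `|` [set set0]).
  + by rewrite -bigcup2E; apply: bigcup_countable => // -[|[|i]] _ //=.
  + by exists set0; right.
  exists (fun m => \bigcup_(i in `I_m) f i); split.
  + elim=> [|m IHm]; first by rewrite II0 bigcup_set0; exact: Ifin.
    rewrite IIS bigcup_setU bigcup_set1; apply: IU => //.
    by have [/SI Ifm| ->] := fS m; [|exact: Ifin].
  + by move=> m n mn x [i /= im fxi]; exists i => //=; exact: leq_trans mn.
  + move=> u x ux nux; case: (Greg) => acc _.
    have [A SA uA] := Scap _ _ (tends_seq_conv acc nux ux).
    have [|i fi] := fsurj A; first by left.
    exists i.+1; apply: (sub_often _ (infinite_range_often uA)) => n /= Aun.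
    by exists i => /=; rewrite ?fi.
- right; have [|f fH fsurj] := countable_enum Hc.
    by have [||A HA _] := Hpi setT; [exact: openT|exists 1%g|exists A].
  exists f; split=> [n|U oU U0]; first exact/HI/fH.
  by have [A /fsurj[n <-] IA] := Hpi U oU U0; exists n.
Qed.

(** * Sequential groups that are not Frechet *)

Section SequentialGroup.
Variable G : topologicalGroupType.
Hypotheses (Greg : t1_completely_regular G) (Gcount : countable [set: G]).
Hypothesis Gseq : sequential_space G.
Local Open Scope group_scope.

Let acc : accessible_space G := Greg.1.

Lemma group_enum : exists e : nat -> G, forall x, exists n, e n = x.
Proof.
by have [|e _ eP] := countable_enum Gcount; [exists 1|exists e => x; apply: eP].
Qed.

(** An entangled [Y] contains no convergent sequence, because an infinite part of it would avoid its
    own limit. Sequentiality then makes [Y] closed, hence everything by density, and after that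
    makes every set closed. *)
Lemma sequential_groomed : ~ discrete_space G -> groomed G.
Proof.
move=> nd [Y [Yd Yent]]; apply: nd.
have trap (C : set G) x : C `<=` Y -> ~ seq_converges_to C x.
  move=> CY Cx; have [|A [AY nAx] CA] := Yent x [set C] (countable1 _).
    by move=> _ ->; split => //; case: Cx.
  have CAinf : infinite_set (C `&` A) by exact: CA.
  apply: nAx => U Ux; apply: contrapT => AU; apply: CAinf.
  apply: (@sub_finite_set _ _ (C `\` U)); last exact: Cx.2.
  by move=> y [Cy Ay]; split => // Uy; apply: AU; exists y.
have YT : Y = setT.
  have Ycl : closed Y.
    apply: contrapT => /Gseq[C [x [CY Cx _]]]; exact: (trap C x).
  apply/seteqP; split=> // x _; apply: Ycl => U.
  rewrite nbhsE => -[O [oO Ox] OU].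
  have [|y [Oy Yy]] := Yd O _ oO; first by exists x.
  by exists y; split => //; exact: OU.
have allclosed (A : set G) : closed A.
  apply: contrapT => /Gseq[C [x [CA Cx _]]].
  by apply: (trap C x) => //; rewrite YT.
apply/funext => x; apply/seteqP; split=> U.
  by move=> /nbhs_singleton ?; apply/principal_filterP.
move=> /principal_filterP Ux; apply: open_nbhs_nbhs; split=> //.
by rewrite -closedC; exact: allclosed.
Qed.

(** Modelled on the sequential fan: the part of the columns below the graph of any [h] stays away
    from 1. *)
Definition fan_columns (gamma : nat -> nat -> G) :=
  [/\ forall k, tends (gamma k) 1, forall k l, gamma k l <> 1 &
    forall h : nat -> nat, exists2 V, nbhs 1 V &
      forall k l, l <= h k -> ~ V (gamma k l)].

(** If [A1], the set of limits of sequences of [A], were sequentially closed it would contain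
    [closure A]. So some [v k] in [A1] converge to a [z] outside [A1], and each [v k] is a limit of
    points [u k l] of [A]. The columns are the quotients of [u k l] by [v k], with initial parts cut
    off. *)
Lemma not_frechet_fan : ~ frechet_space G -> exists gamma, fan_columns gamma.
Proof.
move=> nF.
have [A [x [Ax nA]]] : exists (A : set G) x, closure A x /\
    forall u, (forall n, A (u n)) -> ~ tends u x.
  apply: contrapT => nAx; apply: nF => A x Ax.
  apply: contrapT => nu; apply: nAx; exists A, x; split=> // u uA ux.
  by apply: nu; exists u; split => //; exact/tendsP.
pose A1 := [set z | exists u, (forall n, A (u n)) /\ tends u z].
have AA1 : A `<=` A1 by move=> z Az; exists (fun=> z); split=> //; exact: tends_cst.
have [v [z [vA1 vz nA1z]]] : exists (v : nat -> G) z, [/\ forall n, A1 (v n), tends v z & ~ A1 z].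
  apply: contrapT => nvz.
  have A1cl : closed A1.
    apply: (sequential_closed Gseq) => v z vA1 vz; apply: contrapT => nA1z.
    by apply: nvz; exists v, z.
  by have [u [uA ux]] := A1cl x (closure_subset AA1 Ax); exact: (nA u).
have [N NvA] : exists N, forall n, N <= n -> ~ A (v n).
  apply: not_often => /often_subseq[nu [nuk nuA]]; apply: nA1z.
  by exists (v \o nu); split=> //; exact: tends_subseq.
wlog vA : v N NvA vA1 vz / forall n, ~ A (v n).
  move=> W; apply: (W (fun n => v (n + N)) 0) => //.
  - by move=> n _; apply: NvA; rewrite leq_addl.
  - by apply: (@tends_subseq _ v z (fun n => n + N)) => // k; rewrite leq_addr.
  - by move=> n; apply: NvA; rewrite leq_addl.
have /choice[u uP] : forall k, exists u, (forall n, A (u n)) /\ tends u (v k).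
  by move=> k; exact: vA1.
pose g k l := (v k)^-1 * u k l.
have g1 k : tends (g k) 1.
  have := tends_mul (@tends_cst _ (v k)^-1) (uP k).2.
  by rewrite mulVg.
have [e eP] := group_enum.
(* Column [k] is cut so that it avoids the sets [O j] with [j <= k]; thus a point other than 1 has a
   neighbourhood that meets only finitely many columns. *)
have /choice[O OP] : forall j, exists O, nbhs 1 (~` O) /\ (e j <> 1 -> nbhs (e j) O).
  move=> j; have [ej1|ej1] := pselect (e j = 1).
    by exists set0; rewrite setC0; split=> //; exact: filterT.
  have [O [oO Oe O1]] := separate Greg (nesym ej1).
  by exists O; split=> // _; exact: open_nbhs_nbhs.
have Oev k m : exists t, forall l, t <= l -> forall j, j < m -> ~ O j (g k l).
  elim: m => [|m [t tP]]; first by exists 0.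
  have [t' t'P] := g1 k _ (OP m).1.
  exists (maxn t t') => l; rewrite geq_max => /andP[tl t'l] j.
  rewrite ltnS leq_eqVlt => /orP[/eqP ->|]; first exact: t'P.
  exact: tP.
have /choice[t tP] : forall k, exists t, forall l, t <= l ->
    forall j, j < k.+1 -> ~ O j (g k l) by move=> k; exact: Oev.
pose gamma k l := g k (l + t k).
have gamma1 k : tends (gamma k) 1.
  by apply: (@tends_subseq _ (g k) 1 (fun l => l + t k)) => // l; rewrite leq_addr.
have gammaN1 k l : gamma k l <> 1.
  rewrite /gamma /g => /(congr1 (fun y => v k * y)).
  rewrite mulVKg mulg1 => E; apply: (vA k); rewrite -E; exact: (uP k).1.
exists gamma; split=> // h.
pose Y := [set y | exists k l, l <= h k /\ y = gamma k l].
pose Yf m := [set y | exists k l, [/\ k < m, l <= h k & y = gamma k l]].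
have Yfin m : finite_set (Yf m).
  elim: m => [|m IHm].
    by rewrite (_ : Yf 0 = set0)//; apply/seteqP; split=> // y [k [l []]].
  apply: (@sub_finite_set _ _ (Yf m `|` gamma m @` `I_(h m).+1)); last first.
    by rewrite finite_setU; split=> //; exact/finite_image/finite_II.
  move=> y [k [l [+ lh ->]]]; rewrite ltnS leq_eqVlt => /orP[/eqP <-|km].
    by right; exists l.
  by left; exists k, l.
have YfY m : Yf m `<=` Y by move=> y [k [l [_ ? ?]]]; exists k, l.
have nY1 : ~ Y 1 by move=> [k [l [_ /esym/gammaN1]]].
have Ycl : closed Y.
  apply: (sequential_closed Gseq) => w y wY wy.
  have [y1|ny1] := pselect (y = 1); last first.
    have [n en] := eP y; rewrite -en in ny1.
    have [|N0 NO] := wy (O n); first by rewrite -en; exact: (OP n).2.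
    apply: (YfY n); apply: (tends_finite acc wy) => // M.
    exists (maxn N0 M); rewrite ?leq_maxr//=.
    have [k [l [lh wE]]] := wY (maxn N0 M); exists k, l; split=> //.
    rewrite ltnNge; apply/negP => nk.
    apply: (tP k (l + t k) (leq_addl _ _) n); first by rewrite ltnS.
    by rewrite -/(gamma k l) -wE; apply: NO; rewrite leq_maxl.
  (* Below the graph of [h] each column has finitely many points, so the column indices along [w]
     tend to infinity. Multiplying back by [v (k n)] then gives a sequence of [A] converging to
     [z]. *)
  exfalso; rewrite y1 in wy.
  have wfin m : exists N, forall n, N <= n -> ~ Yf m (w n).
    apply: not_often => /(tends_finite acc wy (Yfin m))/YfY; exact: nY1.
  have /choice[k kP] : forall n, exists k, exists l, l <= h k /\ w n = gamma k l.
    by move=> n; exact: wY.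
  have kinf m : exists M, forall n, M <= n -> m <= k n.
    have [M MP] := wfin m; exists M => n /MP nYf; rewrite leqNgt; apply/negP => km.
    by apply: nYf; have [l [lh wE]] := kP n; exists (k n), l.
  apply: nA1z; exists (fun n => v (k n) * w n); split.
    move=> n; have [l [lh ->]] := kP n; rewrite /gamma /g mulVKg; exact: (uP _).1.
  by rewrite -[z]mulg1; apply: tends_mul => //; exact: tends_unbounded.
exists (~` Y); last by move=> k l lh; apply; exists k, l.
by apply: open_nbhs_nbhs; split=> //; exact: closed_openC.
Qed.

End SequentialGroup.

(** * The ideal of a system of columns *)

Section ColumnIdeal.
Variable G : topologicalGroupType.
Hypothesis Greg : t1_completely_regular G.
Local Open Scope group_scope.
Variable phi : nat -> nat -> G.
Hypotheses (phi1 : forall k, tends (phi k) 1) (phiN1 : forall k l, phi k l <> 1).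

Let acc : accessible_space G := Greg.1.

(** From [x] the columns are used in the order [k-1], ..., 0. They act on the right, so left
    translations commute with [colD]; starting from the closure makes the ideal stable under
    closure. *)
Fixpoint colD k (A : set G) : set G :=
  if k is k'.+1 then [set x | often (fun l => colD k' A (x * phi k' l))]
  else closure A.

Lemma tends_phi x k : tends (fun l => x * phi k l) x.
Proof.
by have := tends_mul (@tends_cst _ x) (phi1 k); rewrite mulg1.
Qed.

Arguments tends_phi : clear implicits.

Lemma colD_sub k A B : A `<=` B -> colD k A `<=` colD k B.
Proof.
move=> AB; elim: k => [|k IHk] /=; first exact: closure_subset.
by move=> x; apply: sub_often => l /IHk.
Qed.

Lemma colDU k A B : colD k (A `|` B) `<=` colD k A `|` colD k B.
Proof.
elim: k => [|k IHk] /=; first by rewrite closureU.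
by move=> x oAB; apply: often_or; apply: sub_often oAB => l /IHk.
Qed.

Lemma colD_closure_sub k A : colD k A `<=` closure A.
Proof.
elim: k => [|k IHk] //= x oA; apply: closed_closure.
by apply: (tends_often_closure (tends_phi x k)); apply: sub_often oA => l /IHk.
Qed.

Lemma colD_closure k A : colD k (closure A) = colD k A.
Proof.
elim: k => [|k /= ->] //=.
by apply/seteqP; split=> [|x]; [exact: closed_closure|exact: subset_closure].
Qed.

Lemma colD_mull k A g x : colD k (fun y => A (g * y)) x -> colD k A (g * x).
Proof.
elim: k x => [|k IHk] x /=; first exact: closure_mullE.
by apply: sub_often => l /IHk; rewrite mulgA.
Qed.

Lemma colD_empty k k' A : k <= k' -> colD k A = set0 -> colD k' A = set0.
Proof.
move=> /subnK <- D0; elim: (k' - k) => [|m IHm] //=.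
by apply/seteqP; split=> // x; rewrite IHm => /(_ 0)[].
Qed.

Definition colI0 A := exists k, colD k A = set0.

Lemma colI0_sub A B : A `<=` B -> colI0 B -> colI0 A.
Proof.
move=> AB [k B0]; exists k; apply/seteqP; split=> // x /(colD_sub AB).
by rewrite B0.
Qed.

Lemma colI0_U A B : colI0 A -> colI0 B -> colI0 (A `|` B).
Proof.
move=> [k A0] [k' B0]; exists (maxn k k'); apply/seteqP; split=> // x /colDU.
by rewrite (colD_empty (leq_maxl _ _) A0) (colD_empty (leq_maxr _ _) B0) setU0.
Qed.

(** One column suffices: if it enters a finite set infinitely often, it repeats a value, which must
    be its limit [x], whereas no [phi 0 l] is 1. *)
Lemma colI0_finite A : finite_set A -> colI0 A.
Proof.
move=> Af; exists 1%N; apply/seteqP; split=> // x.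
move=> /= oA; have : often (A \o (fun l => x * phi 0 l)).
  apply: sub_often oA => l.
  by move/accessible_finite_set_closed: acc => /(_ _ Af); exact.
move=> /(often_finite Af)[a _ xa].
have xa' : x = a.
  by apply: (tends_finite acc (tends_phi x 0) (finite_set1 a)); exact: xa.
have [l _] := xa 0; rewrite xa' => /(congr1 (fun y => a^-1 * y)).
by rewrite mulKg mulVg; exact: phiN1.
Qed.

Lemma colI0_mull A g : colI0 A -> colI0 (fun x => A (g * x)).
Proof.
move=> [k A0]; exists k; apply/seteqP; split=> // x /colD_mull.
by rewrite A0.
Qed.

Lemma colI0_closure A : colI0 A -> colI0 (closure A).
Proof. by move=> [k A0]; exists k; rewrite colD_closure. Qed.

(** [colI0] is already preserved by left translations; the quantifier over [h] builds in right
    translations and inversion. *)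
Definition colI A := forall h,
  colI0 (fun x => A (x * h)) /\ colI0 (fun x => A (h * x^-1)).

Lemma colI_colI0 A : colI A -> colI0 A.
Proof.
by move=> /(_ 1)[+ _]; apply: colI0_sub => x; rewrite mulg1.
Qed.

Lemma colI_ideal : is_ideal colI.
Proof.
split.
- move=> A B AB IB h; have [B1 B2] := IB h.
  by split; [apply: colI0_sub B1 => x /AB|apply: colI0_sub B2 => x /AB].
- move=> A B IA IB h; have [A1 A2] := IA h; have [B1 B2] := IB h.
  by split; [exact: (colI0_U A1 B1)|exact: (colI0_U A2 B2)].
- move=> A Af h; split; apply: colI0_finite.
    by apply: finite_preimage Af => x y _ _; exact: mulIg.
  by apply: finite_preimage Af => x y _ _ /mulgI/invg_inj.
Qed.

Lemma colI_invariant : invariant_ideal colI.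
Proof.
apply: invariant_preimage => [A g IA h|A g IA h|A IA h].
- split.
    apply: colI0_sub (colI0_mull g (IA h).1) => x; by rewrite mulgA.
  by apply: colI0_sub (IA (g * h)).2 => x; rewrite mulgA.
- split; first by apply: colI0_sub (IA (h * g)).1 => x; rewrite mulgA.
  apply: colI0_sub (colI0_mull g^-1 (IA h).2) => x.
  by rewrite invgM invgK mulgA.
- split.
    by apply: colI0_sub (IA h^-1).2 => x; rewrite invgM.
  by apply: colI0_sub (IA h^-1).1 => x; rewrite invgM invgK.
Qed.

Lemma colI_closure A : colI A -> colI (closure A).
Proof.
move=> IA h; split.
  by apply: colI0_sub (colI0_closure (IA h).1) => x; exact: closure_mulr.
apply: colI0_sub (colI0_closure (IA h).2) => x /closure_mull.
by move=> /(@closure_inv _ (fun z => A (h * z))).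
Qed.

End ColumnIdeal.

(** * Tameness of the column ideal *)

Section ColumnTame.
Variable G : topologicalGroupType.
Hypotheses (Gcount : countable [set: G]) (Gseq : sequential_space G).
Local Open Scope group_scope.
Variable phi : nat -> nat -> G.
Hypothesis phi1 : forall k, tends (phi k) 1.

Let D := colD phi.

Section Fibres.
Variables (Y : set G) (f : G -> nat).

Let M n := Y `&` [set x | f x <= n].
Let YB (B : set nat) := Y `&` f @^-1` B.

(** The sets [M n] increase with [n]; [r] is the level at which some term of [u] enters [D k (M n)].
    The sets of such levels are those that [J] will be made to hit. *)
Definition first_in k (u : nat -> G) r :=
  exists l, D k (M r) (u l) /\ forall n, n < r -> ~ D k (M n) (u l).

Lemma M_sub m n : m <= n -> M m `<=` M n.
Proof. by move=> mn x [Yx /= fx]; split=> //=; exact: leq_trans mn. Qed.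

Lemma often_first_in k u :
  (forall n, exists t, forall l, t <= l -> ~ D k (M n) (u l)) ->
  often (fun l => exists n, D k (M n) (u l)) -> often (first_in k u).
Proof.
move=> fin oM N.
have [t tP] : exists t, forall l, t <= l -> forall n, n < N -> ~ D k (M n) (u l).
  have [t tP] := fin N; exists t => l /tP nN n nN'.
  by move=> /(colD_sub (M_sub (ltnW nN'))).
have [l tl [n Dn]] := oM t.
pose P n := `[< D k (M n) (u l) >].
have exP : exists n, P n by exists n; exact/asboolP.
have [r /asboolP Dr rmin] := ex_minnP exP.
exists r; last first.
  exists l; split=> // m mr /asboolP Dm; have := rmin m Dm.
  by rewrite leqNgt mr.
by rewrite leqNgt; apply/negP => /(tP l tl).
Qed.

(** A term has only one entrance level, so infinitely many levels come from infinitely many terms. A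
    term entering at [r] must come from the fibre of [f] over [r]. *)
Lemma first_in_often k u B : often (fun r => first_in k u r /\ B r) ->
  often (D k (YB B) \o u).
Proof.
move=> oB t.
have [N NP] : exists N, forall l r, l < t -> (D k (M r) (u l) /\
    forall n, n < r -> ~ D k (M n) (u l)) -> r < N.
  elim: t => [|t [N NP]]; first by exists 0%N.
  have [[n Dn]|nD] := pselect (exists n, D k (M n) (u t)).
    exists (maxn N n.+1) => l r; rewrite ltnS leq_eqVlt => /orP[/eqP ->|lt Dr].
      move=> [_ rn]; rewrite leq_max ltnS; apply/orP; right.
      by rewrite leqNgt; apply/negP => /rn.
    by rewrite leq_max (NP l r lt Dr).
  exists N => l r; rewrite ltnS leq_eqVlt => /orP[/eqP ->|lt Dr]; last exact: NP Dr.
  by move=> [Dr _]; exfalso; apply: nD; exists r.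
have [r Nr [[l [Dr nDr]] Br]] := oB N.
exists l.
  rewrite leqNgt; apply/negP => lt; have := NP l r lt (conj Dr nDr).
  by rewrite ltnNge Nr.
(* [M r] is the fibre over [r] together with the previous [M]; at level 0 there is only the
   fibre. *)
have : D k (YB B `|` (if r is r'.+1 then M r' else set0)) (u l).
  apply: colD_sub Dr => x [Yx /=]; rewrite leq_eqVlt => /orP[/eqP fxr|fxr].
    by left; split=> //=; rewrite fxr.
  by right; case: r fxr {Nr Br nDr}.
case/colDU => //; case: r {Nr Br Dr} nDr => [_ D0|r /(_ r (ltnSn r))//].
by have := colD_closure_sub phi1 D0; rewrite closure0.
Qed.

(** By countability of the group a single [B] hits all relevant sets of entrance levels. The base
    case shows that the right side is sequentially closed; the inductive step uses the levels along
    one translated column. *)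
Lemma hitting_colD (J : set (set nat)) : is_ideal J -> omega_hitting setT J ->
  exists2 B, J B &
    forall k, D k Y `<=` D k (YB B) `|` \bigcup_n D k (M n).
Proof.
move=> Jid Jhit.
have [e eP] := group_enum Gcount.
(* One sequence per limit [q] is enough: if any sequence converging to [q] has unbounded entrance
   levels, [v] is such a sequence. *)
have /choice[v vP] : forall q : G, exists v, tends v q /\
    ((exists u, tends u q /\ often (first_in 0 u)) -> often (first_in 0 v)).
  move=> q; have [[u [uq ou]]|nu] := pselect (exists u, tends u q /\ often (first_in 0 u)).
    by exists u.
  by exists (fun=> q); split; [exact: tends_cst|move/nu].
pose R (i : nat + nat * nat) := match i with
  | inl i => first_in 0 (v (e i))
  | inr (k, i) => first_in k (fun l => e i * phi k l) end.
have [||B JB BP] := Jhit (R @` [set i | often (R i)]).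
- exact: sub_countable (card_image_le _ _) (countableP _).
- by move=> _ [i oi <-]; split=> //; exact/infinite_natP.
have hit i : often (R i) -> often (fun r => R i r /\ B r).
  by move=> oi; apply/infinite_natP; apply: BP; exists i.
exists B => // k; elim: k => [|k IHk] x /=.
- pose Z := closure (YB B) `|` \bigcup_n D 0 (M n).
  suff Zcl : closed Z.
    move=> Yx; apply: Zcl; apply: closure_subset Yx => y Yy; right.
    by exists (f y) => //; apply: subset_closure; split=> /=.
  apply: (sequential_closed Gseq) => w q wZ wq; apply: contrapT => nZq.
  have wB : exists N, forall n, N <= n -> ~ closure (YB B) (w n).
    apply: not_often => oB; apply: nZq; left; apply: closed_closure.
    exact: tends_often_closure wq oB.
  have wM n : exists t, forall l, t <= l -> ~ D 0 (M n) (w l).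
    apply: not_often => oM; apply: nZq; right; exists n => //.
    by apply: closed_closure; exact: tends_often_closure wq oM.
  have ov : often (first_in 0 (v q)).
    apply: (vP q).2; exists w; split=> //; apply: often_first_in => // N.
    have [N' N'P] := wB; exists (maxn N N'); rewrite ?leq_maxl//.
    have [|[n _ Dn]] := wZ (maxn N N'); last by exists n.
    by move=> /(N'P _ (leq_maxr _ _)).
  have [i iq] := eP q; rewrite -iq in ov.
  have := first_in_often (hit (inl i) ov); rewrite iq => oB.
  apply: nZq; left; apply: closed_closure.
  exact: tends_often_closure (vP q).1 oB.
- move=> oY; apply: contrapT => /not_orP[nB nM].
  have xM n : exists t, forall l, t <= l -> ~ D k (M n) (x * phi k l).
    by apply: not_often => oM; apply: nM; exists n.
  have : often (fun l => D k (YB B) (x * phi k l) \/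
      exists n, D k (M n) (x * phi k l)).
    by apply: sub_often oY => l /IHk[|[n _]]; [left|right; exists n].
  case/often_or => // oM; have [i ix] := eP x; apply: nB.
  rewrite -ix; apply: (@first_in_often k (fun l => e i * phi k l)).
  apply: (hit (inr (k, i))); rewrite /= ix; exact: often_first_in.
Qed.

End Fibres.

(** Either some [D k] kills all fibres of [f], hence all sets with bounded [f], and [hitting_colD]
    leaves only the part over [B]; or each [D k] is nonempty on the fibre over some [r k], and it
    suffices that [B] contains infinitely many [r k]. *)
Lemma colI0_tame : tame (colI0 phi).
Proof.
move=> Y nY f J Jid Jhit.
have Yk k : exists x, D k Y x.
  apply: contrapT => nx; apply: nY; exists k; apply/seteqP; split=> // x Dx.
  by apply: nx; exists x.
have [[k kP]|nk] := pselect (exists k, forall r, D k (Y `&` f @^-1` [set r]) = set0).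
  have [B JB BP] := hitting_colD Y f Jid Jhit; exists B => // -[k' B0].
  have Mempty k1 n : k <= k1 -> D k1 (Y `&` [set x | f x <= n]) = set0.
    move=> kk1; apply: (colD_empty kk1); elim: n => [|n IHn].
      apply/seteqP; split=> // x; rewrite -(kP 0%N); apply: colD_sub => y [Yy /=].
      by rewrite leqn0 => /eqP.
    apply/seteqP; split=> // x Dx.
    suff : colD phi k ((Y `&` f @^-1` [set n.+1]) `|` (Y `&` [set x | f x <= n])) x.
      by move=> /colDU; rewrite IHn [X in X `|` _]kP setU0.
    apply: colD_sub Dx => y [Yy /=]; rewrite leq_eqVlt => /orP[/eqP|]; first by left.
    by right.
  have [x Dx] := Yk (maxn k k').
  have [|[n _]] := BP _ _ Dx; last by rewrite Mempty// leq_maxl.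
  by rewrite /D (colD_empty (leq_maxr _ _) B0).
have /choice[r rP] : forall k, exists r, exists x, D k (Y `&` f @^-1` [set r]) x.
  move=> k; apply: contrapT => nr; apply: nk; exists k => r.
  by apply/seteqP; split=> // x Dx; apply: nr; exists r, x.
have [B JB oB] := hitting_sequence r Jid Jhit; exists B => // -[k k0].
have [k' kk' /= Br] := oB k; have [x Dx] := rP k'.
have : D k' (Y `&` f @^-1` B) x by apply: colD_sub Dx => y [Yy /= ->].
by rewrite /D (colD_empty kk' k0).
Qed.

Lemma colI_tame : tame (colI phi).
Proof.
move=> Y /existsNP[h] /not_andP[nh|nh] f J Jid Jhit.
- have [B JB nB] := colI0_tame nh (f \o (fun x => x * h)) Jid Jhit.
  by exists B => // /(_ h)[].
- have [B JB nB] := colI0_tame nh (f \o (fun x => h * x^-1)) Jid Jhit.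
  by exists B => // /(_ h)[].
Qed.

End ColumnTame.

(** * Catching convergent sequences by sets of the column ideal *)

Section ColumnCapture.
Variable G : topologicalGroupType.
Hypotheses (Greg : t1_completely_regular G) (Gcount : countable [set: G]).
Hypothesis Gseq : sequential_space G.
Hypothesis nondiscrete : ~ discrete_space G.
Local Open Scope group_scope.
Variables (gamma : nat -> nat -> G) (e : nat -> G).
Hypothesis gammaP : fan_columns gamma.
Hypothesis eP : forall x, often (fun k => e k = x).

Definition conj_columns k l := (e k)^-1 * gamma k l * e k.
Local Notation phi := conj_columns.

Lemma conj_columns1 k : tends (phi k) 1.
Proof.
have [g1 _ _] := gammaP.
have := tends_mul (tends_mul (@tends_cst _ (e k)^-1) (g1 k)) (@tends_cst _ (e k)).
by rewrite mulg1 mulVg.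
Qed.

Lemma conj_columnsN1 k l : phi k l <> 1.
Proof.
have [_ gN1 _] := gammaP; rewrite /phi => E; apply: (gN1 k l).
have := congr1 (fun x => e k * x * (e k)^-1) E.
by rewrite !mulgA mulgV mul1g mulgK mulg1 mulgV.
Qed.

Lemma column_capture : IIA -> exists N : nat -> set G,
  [/\ forall m, colI0 phi (N m), forall m n, m <= n -> N m `<=` N n &
      forall u x, tends u x -> (forall n, u n <> x) ->
        exists m, often (N m \o u)].
Proof.
move=> iia.
have phi1 := conj_columns1; have phiN1 := conj_columnsN1.
have [] := IIA_closure iia Greg Gcount (sequential_groomed Gseq nondiscrete)
  (colI_ideal Greg phi1 phiN1) (colI_tame Gcount Gseq phi1)
  (@colI_closure _ phi) (@colI_invariant _ phi).
  by move=> [N [NI Nm Ncap]]; exists N; split=> // m; exact: colI_colI0.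
move=> [H [HI Hpi]]; exfalso.
(* [p n] is the translation, possibly with inversion, under which [H n] stays positive for [colI0].
   On a symmetric set both kinds amount to a right translation by [h n]. *)
have /choice[p pP] : forall n, exists p : G -> G, exists h,
    [/\ ~ colI0 phi (fun x => H n (p x)),
     forall A, colI phi A -> colI0 phi (fun x => A (p x)) &
     forall V : set G, (forall x, V x -> V x^-1) ->
        forall x, V (p x) -> V (x * h)].
  move=> n; have /existsNP[h /not_andP[nh|nh]] := HI n.
    exists (fun x => x * h), h; split=> // A IA; exact: (IA h).1.
  exists (fun x => h * x^-1), h^-1; split=> [//|A IA|V Vs x]; first exact: (IA h).2.
  by move=> /Vs; rewrite invgM invgK.
have /choice[h hP] := pP.
have /choice[x xP] : forall nk : nat * nat, exists x, exists l,
    colD phi nk.2.+1 (fun x => H nk.1 (p nk.1 x)) x /\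
    colD phi nk.2 (fun x => H nk.1 (p nk.1 x)) (x * phi nk.2 l).
  move=> [n k] /=; have [nI _ _] := hP n.
  have [x Dx] : exists x, colD phi k.+1 (fun x => H n (p n x)) x.
    apply: contrapT => nx; apply: nI; exists k.+1.
    by apply/seteqP; split=> // x Dx; apply: nx; exists x.
  by have [l _ Dl] := Dx 0%N; exists x, l.
have /choice[l lP] := xP.
have [_ _ gfan] := gammaP.
(* This bound makes [V] omit [gamma k (l (n, k))] for all [n <= k]. *)
have [V V1 VP] := gfan (fun k => (\max_(n < k.+1) l (nat_of_ord n, k))%N).
have [U [oU U1 Us UV]] := nbhs1_symm V1 Greg.
have [n [i i0]] : exists n, colI0 phi (fun x => (H n `\` U) (p n x)).
  have [|n HU] := Hpi U oU; first by exists 1.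
  by exists n; have [_ + _] := hP n; apply.
(* For this [k] the conjugation in [phi k] cancels [h n]: the points [x (n, k)] and its
   [phi k]-successor, multiplied by [h n], lie in [closure U] and have quotient
   [gamma k (l (n, k))], which would be in [V]. *)
have [k + ek] := eP (h n)^-1 (maxn i n); rewrite geq_max => /andP[ik nk].
have DU k' y : i <= k' -> colD phi k' (fun x => H n (p n x)) y -> closure U (y * h n).
  move=> ik' Dy; suff : closure (fun x => U (x * h n)) y by exact: closure_mulrE.
  apply: (colD_closure_sub phi1 (k := k')).
  have : colD phi k' ((fun x => (H n `\` U) (p n x)) `|` (fun x => U (x * h n))) y.
    apply: colD_sub Dy => z Hz; have [Uz|nUz] := pselect (U (p n z)); last by left.
    by right; have [_ _] := hP n; apply.
  by move=> /colDU; rewrite (colD_empty ik' i0) set0U.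
have [Dx Dxl] := lP (n, k).
have := UV _ _ (DU _ _ (leqW ik) Dx) (DU _ _ ik Dxl); rewrite /= /phi ek invgK invgM.
rewrite -!mulgA mulVg mulg1 !mulKg.
have nk' : n < k.+1 by [].
by apply: VP; exact: (leq_bigmax (Ordinal nk')).
Qed.

End ColumnCapture.

(** * Locally finite sequences *)

Section LocallyFinite.
Variable G : topologicalGroupType.
Hypotheses (Greg : t1_completely_regular G) (Gcount : countable [set: G]).
Hypothesis Gseq : sequential_space G.
Local Open Scope group_scope.

Let acc : accessible_space G := Greg.1.

(** Local finiteness is counted by index, so that a [discrete_seq] takes each value only finitely
    often. *)
Definition loc_finite (E : nat -> set G) :=
  forall x : G, exists2 O, nbhs x O &
    exists N, forall k, N <= k -> forall y, E k y -> ~ O y.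

Lemma loc_finite_sub (E E' : nat -> set G) :
  (forall k, E k `<=` E' k) -> loc_finite E' -> loc_finite E.
Proof.
move=> EE' LF x; have [O Ox [N NO]] := LF x.
by exists O => //; exists N => k /NO Ny y /EE'; exact: Ny.
Qed.

Lemma loc_finite_subseq (E : nat -> set G) (nu : nat -> nat) :
  (forall k, k <= nu k) -> loc_finite E -> loc_finite (E \o nu).
Proof.
move=> nuk LF x; have [O Ox [N NO]] := LF x.
by exists O => //; exists N => k Nk; apply: NO; exact: leq_trans (nuk k).
Qed.

Lemma loc_finite_preimage (E : nat -> set G) (f g : G -> G) :
  (forall x U, nbhs (f x) U -> nbhs x (fun y => U (f y))) ->
  (forall y, f (g y) = y) ->
  loc_finite E -> loc_finite (fun k => g @` E k).
Proof.
move=> fc fg LF x; have [O Ox [N NO]] := LF (f x).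
exists (fun y => O (f y)); first exact: fc.
by exists N => k /NO Ny _ [y Ey <-]; rewrite fg; exact: Ny.
Qed.

(** For large [l] the factor [phi l] is so close to 1 that a product near [x] forces [y] into [O];
    the finitely many smaller [l] give translates of a locally finite family. *)
Lemma loc_finite_mulr (E : nat -> set G) (phi : nat -> G) : tends phi 1 ->
  loc_finite E -> loc_finite (fun k => [set y * phi l | y in E k & l in setT]).
Proof.
move=> phi1 LF x; have [O Ox [N NO]] := LF x.
have [|P [Q [Px Q1 PQ]]] := @nbhs_mul G x 1 O; first by rewrite mulg1.
have [|L LQ] := tends_inv phi1 (U := Q); first by rewrite invg1.
have [O' O'x [N' NO']] : exists2 O', nbhs x O' & exists N, forall k, N <= k ->
    forall y l, l < L -> E k y -> ~ O' (y * phi l).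
  elim: L {LQ} => [|L [O' O'x [N' NO']]]; first by exists setT; [exact: filterT|exists 0%N].
  have [O1 O1x [N1 NO1]] := LF (x * (phi L)^-1).
  exists (O' `&` (fun y => O1 (y * (phi L)^-1))).
    by apply: filterI => //; exact: nbhs_mulr.
  exists (maxn N' N1) => k; rewrite geq_max => /andP[N'k N1k] y l.
  rewrite ltnS leq_eqVlt => /orP[/eqP ->|lL] Ey [].
    by move=> _; rewrite mulgK; exact: NO1 Ey.
  by move=> + _; exact: NO' Ey.
exists (O' `&` P); first exact: filterI.
exists (maxn N N') => k; rewrite geq_max => /andP[Nk N'k] _ [y Ey [l _ <-]] [O'y Py].
have [Ll|lL] := leqP L l; last exact: (NO' k N'k y l lL Ey).
apply: (NO k Nk y Ey); rewrite -[y](mulgK (phi l)); apply: PQ => //.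
exact: LQ.
Qed.

Definition discrete_seq (d : nat -> G) := loc_finite (fun k => [set d k]).

Lemma discrete_seq_subseq d (nu : nat -> nat) :
  (forall k, k <= nu k) -> discrete_seq d -> discrete_seq (d \o nu).
Proof. exact: loc_finite_subseq. Qed.

Lemma discrete_seq_homeo d (f g : G -> G) :
  (forall x U, nbhs (f x) U -> nbhs x (fun y => U (f y))) ->
  (forall y, f (g y) = y) ->
  discrete_seq d -> discrete_seq (g \o d).
Proof.
move=> fc fg /(loc_finite_preimage fc fg).
by apply: loc_finite_sub => k _ ->; exists (d k).
Qed.

Lemma not_discrete_often d x : often (fun n => d n = x) -> ~ discrete_seq d.
Proof.
move=> od /(_ x)[O Ox [N NO]]; have [n Nn dn] := od N.
by apply: (NO n Nn (d n)) => //; rewrite dn; exact: nbhs_singleton.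
Qed.

Definition no_discrete A := ~ exists2 d, discrete_seq d & forall k, A (d k).

Lemma no_discrete_often A d : no_discrete A -> discrete_seq d -> ~ often (A \o d).
Proof.
move=> nA LF /often_subseq[nu [nuk nuA]]; apply: nA.
by exists (d \o nu) => //; exact: discrete_seq_subseq.
Qed.

Lemma no_discrete_ideal : is_ideal no_discrete.
Proof.
split.
- by move=> A B AB nB [d LF dA]; apply: nB; exists d => // k; exact: AB.
- move=> A B nA nB [d LF dAB].
  have : often (fun k => A (d k) \/ B (d k)) by move=> N; exists N => //; exact: dAB.
  case/often_or => o; first exact: (no_discrete_often nA LF o).
  exact: (no_discrete_often nB LF o).
- move=> A Af [d LF dA]; have [|a _ oa] := @often_finite _ A d Af.
    by move=> N; exists N => //; exact: dA.
  exact: not_discrete_often oa LF.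
Qed.

Lemma no_discrete_invariant : invariant_ideal no_discrete.
Proof.
apply: invariant_preimage => [A g|A g|A] nA [d LF dA]; apply: nA.
- exists ((fun y => g * y) \o d) => //.
  apply: (@discrete_seq_homeo _ (fun y => g^-1 * y)) LF => [x U|y].
    exact: nbhs_mull.
  exact: mulKg.
- exists ((fun y => y * g) \o d) => //.
  apply: (@discrete_seq_homeo _ (fun y => y * g^-1)) LF => [x U|y].
    exact: nbhs_mulr.
  exact: mulgK.
- exists ((fun y => y^-1) \o d) => //.
  apply: (@discrete_seq_homeo _ (fun y => y^-1)) LF => [x U|y].
    exact: nbhs_inv.
  exact: invgK.
Qed.

Lemma no_discrete_tame : tame no_discrete.
Proof.
move=> Y /contrapT[d LF dY] f J Jid Jhit.
have [B JB oB] := hitting_sequence (f \o d) Jid Jhit; exists B => // nYB.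
apply: (no_discrete_often nYB LF); apply: sub_often oB => n Bn.
by split => //; exact: dY.
Qed.

(** Each [d k] is replaced by a nearby point of [A] that still avoids those of the first [k+1] sets
    [closure (O i)] which [d k] avoids; this preserves local finiteness. *)
Lemma no_discrete_closure A : no_discrete A -> no_discrete (closure A).
Proof.
move=> nA [d LF dA]; apply: nA; have [e eP] := group_enum Gcount.
have /choice[O OP] : forall i, exists O, [/\ open O, O (e i) &
    exists N, forall k, N <= k -> ~ closure O (d k)].
  move=> i; have [O Oe [N NO]] := LF (e i).
  have [V [oV Ve VO]] := closed_nbhs Greg Oe; exists V; split => //.
  by exists N => k /NO /(_ _ erefl) nO /VO.
pose W k y := forall i : 'I_k.+1, ~ closure (O i) (d k) -> ~ closure (O i) y.
have Wd k : nbhs (d k) (W k).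
  apply: filter_forall => i.
  have [Od|nOd] := pselect (closure (O i) (d k)).
    by apply: filterS filterT => y _ /(_ Od).
  apply: (@filterS _ _ _ (~` closure (O i))) => [y nO _ //|].
  by apply: open_nbhs_nbhs; split=> //; exact/closed_openC/closed_closure.
have /choice[y yP] : forall k, exists y, A y /\ W k y.
  by move=> k; have [y] := dA k _ (Wd k); exists y.
exists y; last by move=> k; have [] := yP k.
move=> x; have [i <-] := eP x; have [oO Oe [N NO]] := OP i.
exists (O i); first exact: open_nbhs_nbhs.
exists (maxn N i) => k; rewrite geq_max => /andP[Nk ik] _ -> Oy.
have [_ /(_ (Ordinal (ik : i < k.+1)))] := yP k; apply; first exact: NO.
exact: subset_closure.
Qed.

(* The range of a sequence without convergent subsequences, minus any point, is
   sequentially closed, hence closed. *)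
Lemma no_discrete_compact A : closed A -> no_discrete A ->
  forall u, (forall n, A (u n)) ->
  exists nu z, [/\ forall k, k <= nu k, tends (u \o nu) z & A z].
Proof.
move=> Acl nA u uA; apply: contrapT => nsub.
have {}nsub nu z : (forall k, k <= nu k) -> ~ tends (u \o nu) z.
  move=> nuk uz; apply: nsub; exists nu, z; split => //.
  by apply: Acl; apply: (tends_closure uz) => n; exact: uA.
apply: nA; exists u => // x.
have xfin : exists N, forall k, N <= k -> u k <> x.
  apply: not_often => /often_subseq[nu [nuk nux]]; apply: (nsub nu x nuk).
  rewrite (_ : u \o nu = fun=> x); first exact: tends_cst.
  by apply/funext => k /=.
have Ecl : closed (range u `\ x).
  apply: (sequential_closed Gseq) => w z wE wz.
  have /choice[k kP] : forall n, exists k, u k = w n.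
    by move=> n; have [[k _ <-] _] := wE n; exists k.
  have [[N oN]|kinf] := pselect (exists N, often (fun n => k n < N)).
    have : ((u @` `I_N) `\ x) z.
      apply: (tends_finite acc wz); first exact/finite_setD/finite_image/finite_II.
      apply: sub_often oN => n kn; split; first by exists (k n).
      by have [] := wE n.
    by move=> [[m _ <-] mx]; split => //; exists m.
  exfalso.
  have /choice[m mP] : forall N, exists n, N <= n /\ N <= k n.
    move=> N; apply: contrapT => nn; apply: kinf; exists N => M.
    exists (maxn M N); rewrite ?leq_maxl// ltnNge; apply/negP => Nk.
    by apply: nn; exists (maxn M N); rewrite leq_maxr.
  apply: (nsub (k \o m) z); first by move=> N; have [] := mP N.
  rewrite (_ : u \o (k \o m) = w \o m); last by apply/funext => n /=.
  by apply: tends_subseq wz => N; have [] := mP N.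
exists (~` (range u `\ x)).
  by apply: open_nbhs_nbhs; split; [exact: closed_openC|case=> _; apply].
have [N Nx] := xfin; exists N => k /Nx kx _ -> nE; apply: nE.
by split => //; exists k.
Qed.

End LocallyFinite.

(** * Catching convergent sequences by sequentially compact sets *)

Section CompactCapture.
Variable G : topologicalGroupType.
Hypotheses (Greg : t1_completely_regular G) (Gcount : countable [set: G]).
Hypothesis Gseq : sequential_space G.
Local Open Scope group_scope.

Let acc : accessible_space G := Greg.1.

Section Columns.
Variable phi : nat -> nat -> G.
Hypothesis phi1 : forall k, tends (phi k) 1.

(* The products [phi (r-1) l_(r-1) * ... * phi 0 l_0] with all [l_i >= t]. *)
Fixpoint col_prod r t : set G :=
  if r is r'.+1 then [set phi r' l * y | l in [set l | t <= l] & y in col_prod r' t]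
  else [set 1].

(** At each step the next point of the column can be taken arbitrarily far out while staying outside
    the next [colD]; this allows the factors to be as close to 1 as desired. *)
Lemma col_prod_escape r N x t : ~ colD phi r N x ->
  exists2 y, col_prod r t y & ~ N (x * y).
Proof.
elim: r x => [|r IHr] x /= nD.
  by exists 1 => //; rewrite mulg1 => /subset_closure.
have [M MD] := not_often nD.
have [y yr nN] := IHr (x * phi r (maxn t M)) (MD _ (leq_maxr _ _)).
exists (phi r (maxn t M) * y); last by rewrite mulgA.
by exists (maxn t M); [rewrite /= leq_maxl|exists y].
Qed.

Lemma col_prod_sub r t t' : t <= t' -> col_prod r t' `<=` col_prod r t.
Proof.
move=> tt'; elim: r => [|r IHr] //= _ [l t'l [y /IHr yr <-]].
by exists l; [exact: leq_trans t'l|exists y].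
Qed.

Lemma col_prod_nbhs r U : nbhs 1 U -> exists t, col_prod r t `<=` U.
Proof.
elim: r U => [|r IHr] U U1; first by exists 0%N => _ ->; exact: nbhs_singleton.
have [|V [W [/(phi1 r)[M MV] /IHr[t tW] VW]]] := @nbhs_mul G 1 1 U.
  by rewrite mulg1.
exists (maxn M t) => _ [l /= + [y yr <-]]; rewrite geq_max => /andP[Ml tl].
by apply: VW; [exact: MV|apply: tW; exact: col_prod_sub (leq_maxr _ _) _ yr].
Qed.

Lemma col_prod_loc_finite r (E : nat -> set G) : loc_finite E ->
  loc_finite (fun k => [set x * y | x in E k & y in col_prod r 0]).
Proof.
elim: r E => [|r IHr] E LF.
  by apply: loc_finite_sub LF => k _ [x Ex [_ -> <-]]; rewrite mulg1.
apply: loc_finite_sub (IHr _ (loc_finite_mulr (phi1 r) LF)) => k.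
move=> _ [x Ex [_ [l _ [y yr <-]] <-]]; exists (x * phi r l).
  by exists x => //; exists l.
by exists y; rewrite // mulgA.
Qed.

End Columns.

Lemma no_discrete_net_false (phi : nat -> nat -> G) (N : nat -> set G)
    (d : nat -> nat -> G) :
  (forall k, tends (phi k) 1) ->
  (forall m, colI0 phi (N m)) -> (forall m n, m <= n -> N m `<=` N n) ->
  (forall u x, tends u x -> (forall n, u n <> x) -> exists m, often (N m \o u)) ->
  (forall m, N m 1) ->
  (forall n, discrete_seq (d n)) ->
  (forall U, open U -> U !=set0 -> exists n M, forall k, M <= k -> U (d n k)) ->
  False.
Proof.
move=> phi1 ND Nmono Ncap N1 LF dU.
have /choice[r rP] : forall m, exists r, colD phi r (N m) = set0 by move=> m; exact: ND.
have /choice[b bP] : forall mkt : nat * nat * nat, exists y,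
    col_prod phi (r mkt.1.1) mkt.2 y /\ ~ N mkt.1.1 (d mkt.1.1 mkt.1.2 * y).
  move=> [[m k] t] /=; have [|y] := @col_prod_escape phi (r m) (N m) (d m k) t.
    by rewrite rP.
  by exists y.
(* The condition [t <= k] leaves finitely many points for each [k], so [A m] is locally finite; by
   the choice of [b] it misses [N m]. *)
pose A m := [set x | exists k t, t <= k /\ x = d m k * b (m, k, t)].
have Afin m (x : G) : exists2 O, nbhs x O & finite_set (A m `&` O).
  have [O Ox [K KO]] := col_prod_loc_finite phi1 (r m) (LF m) x.
  exists O => //.
  apply: (@sub_finite_set _ _ ((fun kt => d m kt.1 * b (m, kt.1, kt.2)) @`
     (`I_K `*` `I_K))); last by apply/finite_image/finite_setX; exact: finite_II.
  move=> _ [[k [t [tk ->]]] Ok].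
  have kK : k < K.
    rewrite ltnNge; apply/negP => /KO /(_ (d m k * b (m, k, t))); apply => //.
    exists (d m k) => //; exists (b (m, k, t)) => //.
    exact: (col_prod_sub (leq0n _) (bP (m, k, t)).1).
  by exists (k, t) => //=; split=> //=; exact: leq_ltn_trans kK.
have AN m : A m `&` N m = set0.
  apply/seteqP; split=> // _ [[k [t [_ ->]]]].
  exact: (bP (m, k, t)).2.
have Ucl : closed (\bigcup_m A m).
  apply: (sequential_closed Gseq) => u z uA uz; apply: contrapT => nAz.
  have [|j oj] := Ncap u z uz; first by move=> n un; apply: nAz; rewrite -un.
  (* Terms of [u] in [N j] come from some [A m] with [m < j], since [A m] misses [N m], which
     contains [N j] otherwise. These finitely many [A m] have finitely many points near [z]. *)
  have [O Oz Ofin] : exists2 O, nbhs z O &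
      finite_set ((\bigcup_(m in `I_j) A m) `&` O).
    elim: {oj} j => [|j [O Oz Ofin]].
      by exists setT; [exact: filterT|rewrite II0 bigcup_set0 set0I].
    have [O' O'z O'fin] := Afin j z; exists (O `&` O'); first exact: filterI.
    apply: (@sub_finite_set _ _ (((\bigcup_(m in `I_j) A m) `&` O) `|` (A j `&` O'))).
      move=> x [[m /= + Ax] [Ox O'x]]; rewrite ltnS leq_eqVlt => /orP[/eqP mj|mj].
        by right; rewrite -mj.
      by left; split => //; exists m.
    by rewrite finite_setU.
  have [M MO] := uz _ Oz.
  have := tends_finite acc uz Ofin; case.
    apply: sub_often (often_and oj MO) => n /= [Nu Ou]; split=> //.
    have [m _ Am] := uA n; exists m => //=; rewrite ltnNge; apply/negP => jm.
    have : (A m `&` N m) (u n) by split => //; exact: Nmono Nu.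
    by rewrite AN.
  by move=> [m _ Am] _; apply: nAz; exists m.
(* Near 1 take [d n k] with [k] large and a product of columns with [t] large; 1 then lies in the
   closed union, although every [N m] contains 1. *)
have [m _ Am1] : (\bigcup_m A m) 1.
  apply: Ucl => U U1; have [|V [W [V1 W1 VW]]] := @nbhs_mul G 1 1 U.
    by rewrite mulg1.
  have [||n [K KV]] := dU (V°).
  - exact: open_interior.
  - by exists 1.
  have [t tW] := col_prod_nbhs phi1 (r n) W1.
  exists (d n (maxn K t) * b (n, maxn K t, t)); split.
    by exists n => //; exists (maxn K t), t; rewrite leq_maxr.
  apply: VW; first by apply: interior_subset; apply: KV; rewrite leq_maxl.
  exact/tW/(bP (n, maxn K t, t)).1.
have : (A m `&` N m) 1 by split.
by rewrite AN.
Qed.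

Definition compact_capture (T : topologicalType) := exists K : nat -> set T,
  [/\ forall m, closed (K m),
      forall m u, (forall n, K m (u n)) ->
        exists nu z, [/\ forall k, k <= nu k, tends (u \o nu) z & K m z],
      forall m n, m <= n -> K m `<=` K n &
      forall u x, tends u x -> (forall n, u n <> x) -> exists m, often (K m \o u)].

Lemma nondiscrete_compact_capture : IIA -> ~ discrete_space G ->
  ~ frechet_space G -> compact_capture G.
Proof.
move=> iia nd nF; have Gg := sequential_groomed Gseq nd.
have [gamma gammaP] := not_frechet_fan Greg Gcount Gseq nF.
have [|e _ eP] := countable_enum_often Gcount; first by exists 1.
have {}eP x : often (fun k => e k = x) by exact: eP.
have phi1 := conj_columns1 e gammaP.
have phiN1 k l : conj_columns gamma e k l <> 1 by exact: conj_columnsN1.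
have [N [ND Nmono Ncap]] := column_capture Greg Gcount Gseq nd gammaP eP iia.
have [[K [KI Kmono Kcap]]|[H [HI HU]]] := IIA_closure iia Greg Gcount Gg
  (@no_discrete_ideal G) (@no_discrete_tame G)
  (no_discrete_closure Greg Gcount) (@no_discrete_invariant G).
  exists (fun m => closure (K m)); split.
  - by move=> m; exact: closed_closure.
  - move=> m; apply: no_discrete_compact => //; first exact: closed_closure.
    exact: no_discrete_closure.
  - by move=> m n mn; exact/closure_subset/Kmono.
  - move=> u x ux nux; have [m om] := Kcap u x ux nux; exists m.
    by apply: sub_often om => n /= /subset_closure.
exfalso; have /choice[d dP] : forall n, exists d, discrete_seq d /\ forall k, H n (d k).
  by move=> n; have /contrapT[d LF dH] := HI n; exists d.
apply: (@no_discrete_net_false (conj_columns gamma e) (fun m => N m `|` [set 1]) d) => //.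
- by move=> m; apply: colI0_U => //; apply: colI0_finite => //; exact: finite_set1.
- by move=> m n mn x [/(Nmono m n mn)|]; [left|right].
- move=> u x ux nux; have [m om] := Ncap u x ux nux; exists m.
  by apply: sub_often om => n; left.
- by move=> m; right.
- by move=> n; have [] := dP n.
- move=> U oU U0; have [n nHU] := HU U oU U0; exists n.
  apply: contrapT => nM; apply: (no_discrete_often nHU (dP n).1).
  apply: sub_often (often_not nM) => k nU; split=> //; exact: (dP n).2.
Qed.

(** Finite sets serve, as a discrete space has no nontrivial convergent sequence to catch. *)
Lemma discrete_compact_capture : discrete_space G -> compact_capture G.
Proof.
move=> disc; have [e eP] := group_enum Gcount.
have Kfin m : finite_set (e @` `I_m) by exact/finite_image/finite_II.
exists (fun m => e @` `I_m); split.
- by move=> m; move/accessible_finite_set_closed: acc; apply.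
- move=> m u uK; have [|a Ka /often_subseq[nu [nuk nua]]] := @often_finite _ _ u (Kfin m).
    by move=> n; exists n => //; exact: uK.
  exists nu, a; split => //; rewrite (_ : u \o nu = fun=> a); first exact: tends_cst.
  by apply/funext => k /=.
- by move=> m n mn _ [i im <-]; exists i => //; exact: leq_trans mn.
- move=> u x ux nux; exfalso; have [|n un] := ux [set x].
    by rewrite disc; apply/principal_filterP.
  exact: (nux n (un n (leqnn n))).
Qed.

End CompactCapture.

(** * Finite products *)

Lemma tends_coord (I : eqType) (X : I -> topologicalType)
    (u : nat -> prod_topology X) x i :
  tends u x -> tends (fun n => u n i) (x i).
Proof. by move=> ux U /(@proj_continuous I X i x)/ux. Qed.

Lemma tends_prod (I : eqType) (X : I -> topologicalType)
    (u : nat -> prod_topology X) x :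
  (forall i, tends (fun n => u n i) (x i)) -> tends u x.
Proof.
move=> ux; apply/tendsP/cvg_sup => i A [_ [[O oO <-] /= Oxi OA]].
have [|N NO] := ux i O; first exact: open_nbhs_nbhs.
by exists N => // n /NO Oun; exact: OA.
Qed.

Lemma nbhs_box (I : finType) (X : I -> topologicalType) (x : prod_topology X)
    (U : forall i, set (X i)) :
  (forall i, nbhs (x i) (U i)) -> nbhs x [set y : prod_topology X | forall i, U i (y i)].
Proof.
move=> Ux.
apply: (@filter_forall _ I (fun i (y : prod_topology X) => U i (y i)) (nbhs x)) => i.
exact: (@proj_continuous I X i x _ (Ux i)).
Qed.

Section FiniteProduct.
Variables (I : finType) (X : I -> topologicalType).
Hypotheses (Xreg : forall i, t1_completely_regular (X i))
  (Xcount : forall i, countable [set: X i])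
  (Xseq : forall i, sequential_space (X i))
  (XK : forall i, compact_capture (X i)).

Lemma compact_capture_point (T : topologicalType) (x : T) : accessible_space T ->
  compact_capture T -> exists K : nat -> set T,
  [/\ forall m, closed (K m),
      forall m u, (forall n, K m (u n)) ->
        exists nu z, (forall k, k <= nu k) /\ tends (u \o nu) z,
      forall m n, m <= n -> K m `<=` K n,
      forall u x, tends u x -> (forall n, u n <> x) -> exists m, often (K m \o u) &
      forall m, K m x].
Proof.
move=> acc [K [Kcl Kseq Kmono Kcap]]; exists (fun m => K m `|` [set x]); split.
- by move=> m; apply: closedU; [exact: Kcl|exact: accessible_closed_set1].
- move=> m u uK; have : often (fun n => K m (u n) \/ u n = x).
    by move=> n; exists n => //; exact: uK.
  case/often_or => /often_subseq[nu [nuk nuK]].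
    have [mu [z [muk uz _]]] := Kseq m (u \o nu) nuK.
    by exists (nu \o mu), z; split=> // k /=; exact: leq_trans (nuk _).
  exists nu, x; split => //; rewrite (_ : u \o nu = fun=> x); first exact: tends_cst.
  by apply/funext => k /=.
- by move=> m n mn y [/(Kmono m n mn)|]; [left|right].
- move=> u y uy nuy; have [m om] := Kcap u y uy nuy; exists m.
  by apply: sub_often om => n; left.
- by move=> m; right.
Qed.

(** Subsequences are extracted for one coordinate after another, along the finite enumeration of
    [I]. *)
Lemma diagonal_subseq (K : forall i, set (X i)) (a : nat -> prod_topology X) :
  (forall i u, (forall n, K i (u n)) ->
     exists nu z, (forall k, k <= nu k) /\ tends (u \o nu) z) ->
  (forall n i, K i (a n i)) ->
  exists nu z, (forall k, k <= nu k) /\ tends (a \o nu) z.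
Proof.
move=> Kseq aK.
suff [nu nuk nuP] : exists2 nu, (forall k, k <= nu k) &
    forall i, i \in enum I -> exists z, tends (fun n => a (nu n) i) z.
  have zP i : exists z, tends (fun n => a (nu n) i) z by apply: nuP; rewrite mem_enum.
  exists nu, (fun i => projT1 (cid (zP i))); split => //.
  by apply: tends_prod => i; exact: (projT2 (cid (zP i))).
elim: (enum I) => [|i s [nu nuk nuP]]; first by exists id.
have [mu [z [muk uz]]] := Kseq i (fun n => a (nu n) i) (fun n => aK _ _).
exists (nu \o mu) => [k|j]; first by rewrite /=; exact: leq_trans (nuk _).
rewrite inE => /orP[/eqP ->|/nuP[z' uz']]; first by exists z.
by exists z'; exact: (tends_subseq muk uz').
Qed.

Lemma prod_accessible : accessible_space (prod_topology X).
Proof.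
move=> x y /eqP xy; have [i xyi] : exists i, x i <> y i.
  by apply: contrapT => nxy; apply: xy; apply: functional_extensionality_dep => i;
    apply: contrapT => xyi; apply: nxy; exists i.
have [acc _] := Xreg i; have /acc[U [oU]] : x i != y i by exact/eqP.
rewrite !inE => Ux nUy; exists ((@proj I X i) @^-1` U); rewrite !inE; split=> //.
rewrite openE => z Uz; apply: (@proj_continuous I X i z).
exact: open_nbhs_nbhs.
Qed.

(** Countably many open [Q i j], with closures missing [F i], cover its complement. [F'] is [K]
    without the first [p] of them. If no [p] worked, points of [A] in these boxes would have a
    subsequence converging to a point of [A] in the box [F]. *)
Lemma product_step (A : set (prod_topology X)) (K F : forall i, set (X i)) :
  seq_closed A ->
  (forall i, closed (K i)) ->
  (forall i u, (forall n, K i (u n)) ->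
     exists nu z, (forall k, k <= nu k) /\ tends (u \o nu) z) ->
  (forall i, closed (F i)) -> (forall i, F i `<=` K i) ->
  ~ (exists2 y, A y & forall i, F i (y i)) ->
  exists F' : forall i, set (X i),
    [/\ forall i, closed (F' i), forall i, F' i `<=` K i,
        ~ (exists2 y, A y & forall i, F' i (y i)) &
        forall i, exists W, [/\ open W, F i `<=` W & W `&` K i `<=` F' i]].
Proof.
move=> Acl Kcl Kseq Fcl FK FA.
have exQ i : exists Q : nat -> set (X i), [/\ forall j, open (Q j),
    forall j, closure (Q j) `&` F i = set0 & forall y, ~ F i y -> exists j, Q j y].
  have [[x _]|nx] := pselect (exists x : X i, True); last first.
    exists (fun=> set0); split; [move=> _; exact: open0| |].
      by move=> j; rewrite closure0 set0I.
    by move=> y; case: nx; exists y.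
  have [|g _ gP] := countable_enum (Xcount i); first by exists x.
  have /choice[Q Qj] : forall j, exists Q, [/\ open Q, closure Q `&` F i = set0 &
      ~ F i (g j) -> Q (g j)].
    move=> j; have [Fj|nFj] := pselect (F i (g j)).
      by exists set0; split=> //; [exact: open0|rewrite closure0 set0I].
    have [|V [oV Vj VF]] := @closed_nbhs _ (Xreg i) (g j) (~` F i).
      by apply: open_nbhs_nbhs; split=> //; exact/closed_openC/Fcl.
    exists V; split=> //; apply/seteqP; split=> // y [/VF nFy Fy]; exact: nFy.
  exists Q; split=> [j|j|y nFy]; first by have [] := Qj j.
    by have [] := Qj j.
  have [j gj] := gP y Logic.I; exists j; have [_ _] := Qj j.
  by rewrite gj; apply.
pose Q i := projT1 (cid (exQ i)).
have QP i : [/\ forall j, open (Q i j), forall j, closure (Q i j) `&` F i = set0 &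
    forall y, ~ F i y -> exists j, Q i j y] by exact: (projT2 (cid (exQ i))).
pose Fp p i := K i `&` ~` (\bigcup_(j in `I_p) Q i j).
have [p pA] : exists p, ~ (exists2 y, A y & forall i, Fp p i (y i)).
  apply: contrapT => np.
  have /choice[a aP] : forall p, exists y, A y /\ forall i, Fp p i (y i).
    move=> p; apply: contrapT => ny; apply: np; exists p => -[y Ay yF].
    by apply: ny; exists y.
  have [|nu [z [nuk az]]] := diagonal_subseq (K := K) (a := a) Kseq.
    by move=> n i; have [_ /(_ i)[]] := aP n.
  apply: FA; exists z; first by apply: Acl az => n; have [] := aP (nu n).
  move=> i; have [Qo _ Qc] := QP i; apply: contrapT => /Qc[j Qz].
  have [|N NQ] := tends_coord (i := i) az (U := Q i j); first by apply: open_nbhs_nbhs; split.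
  have [_ /(_ i)[_]] := aP (nu (maxn N j.+1)); apply; exists j.
    by rewrite /=; apply: leq_trans (nuk _); rewrite leq_maxr.
  by apply: NQ; rewrite leq_maxl.
exists (Fp p); split => //.
- move=> i; apply: closedI => //; apply: open_closedC.
  by apply: bigcup_open => j _; have [] := QP i.
- by move=> i y [].
- move=> i; have [Qo QF _] := QP i.
  exists (~` (\bigcup_(j in `I_p) closure (Q i j))); split.
  + apply: closed_openC; apply: closed_bigcup; first exact: finite_II.
    by move=> j _; exact: closed_closure.
  + move=> y Fy [j _ Qy]; have : (closure (Q i j) `&` F i) y by [].
    by rewrite QF.
  + move=> y [nQ Ky]; split=> // -[j jp Qy]; apply: nQ; exists j => //.
    exact: subset_closure.
Qed.

(** Starting from the point [x], [product_step] builds boxes [F n] missing [A], each [F n.+1] being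
    a neighbourhood of [F n] relative to [K n.+1]. Their union is an open box around [x] missing
    [A]. *)
Lemma finite_product_sequential : sequential_space (prod_topology X).
Proof.
move=> A nAcl; apply: contrapT => nC; apply: nAcl => x Ax.
have Acl : seq_closed A.
  move=> u y uA uy; apply: contrapT => nAy; apply: nC; exists (range u), y.
  split => //; first by move=> _ [n _ <-].
  apply: tends_seq_conv uy => //; first exact: prod_accessible.
  by move=> n uny; apply: nAy; rewrite -uny.
apply: contrapT => nAx.
pose K i := projT1 (cid (compact_capture_point (x i) (Xreg i).1 (XK i))).
have KP i : [/\ forall m, closed (K i m),
      forall m u, (forall n, K i m (u n)) ->
        exists nu z, (forall k, k <= nu k) /\ tends (u \o nu) z,
      forall m n, m <= n -> K i m `<=` K i n,
      forall u x, tends u x -> (forall n, u n <> x) -> exists m, often (K i m \o u) &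
      forall m, K i m (x i)].
  exact: (projT2 (cid (compact_capture_point (x i) (Xreg i).1 (XK i)))).
pose Inv n (F : forall i, set (X i)) := [/\ forall i, closed (F i),
  forall i, F i `<=` K i n & ~ (exists2 y, A y & forall i, F i (y i))].
(* The invariant is a premise so that [step] is total; where it fails the value is arbitrary. *)
have /choice[step stepP] : forall nF : nat * (forall i, set (X i)), exists F',
    Inv nF.1 nF.2 -> Inv nF.1.+1 F' /\
    forall i, exists W, [/\ open W, nF.2 i `<=` W & W `&` K i nF.1.+1 `<=` F' i].
  move=> [n F] /=; have [[Fcl FK FA]|nI] := pselect (Inv n F); last first.
    by exists F => /nI.
  have [|||||F' [F'cl F'K F'A FW]] := @product_step A (fun i => K i n.+1) F Acl.
  - by move=> i; have [] := KP i.
  - by move=> i u; have [_ + _ _ _] := KP i; apply.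
  - exact: Fcl.
  - by move=> i y /FK; have [_ _ + _ _] := KP i; apply.
  - exact: FA.
  by exists F' => _; split.
pose F := fix F n := if n is m.+1 then step (m, F m) else fun i => [set x i].
have FI n : Inv n (F n).
  elim: n => [|n IHn]; last by have [] := stepP (n, F n) IHn.
  split=> [i|i _ ->|[y Ay yx]].
  - by apply: accessible_closed_set1; exact: (Xreg i).1.
  - by have [_ _ _ _] := KP i; apply.
  - apply: nAx; rewrite (_ : x = y)//.
    by apply: functional_extensionality_dep => i; rewrite yx.
have FW n i : exists W, [/\ open W, F n i `<=` W & W `&` K i n.+1 `<=` F n.+1 i].
  by have [_] := stepP (n, F n) (FI n); apply.
have Fmono i m n : m <= n -> F m i `<=` F n i.
  move=> /subnK <-; elim: (n - m) => [|k IHk] // y /IHk Fy.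
  have [W [_ FWk]] := FW (k + m) i; apply; split; first exact: FWk.
  have [_ FK _] := FI (k + m); have [_ _ Kmono _ _] := KP i.
  exact: Kmono (leqnSn (k + m)) _ (FK _ _ Fy).
(* A sequence outside the union converging into it would often lie in some [K m] and eventually in
   [W], hence often in a later [F]. *)
have Uopen i : open (\bigcup_n F n i).
  rewrite -closedC; apply: (sequential_closed (@Xseq i)) => w z wU wz [n _ Fz].
  have [_ _ Kmono Kcap _] := KP i.
  have [|m om] := Kcap w z wz.
    by move=> k wk; apply: (wU k); rewrite wk; exists n.
  have [W [oW FWn]] := FW (maxn m n) i.
  have Wz : nbhs z W.
    by apply: open_nbhs_nbhs; split=> //; apply: FWn; exact: Fmono (leq_maxr m n) _ Fz.
  have [N NW] := wz W Wz; have [k Nk Kk] := om N.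
  move=> /(_ (w k)) F'w; apply: (wU k); exists (maxn m n).+1 => //; apply: F'w.
  by split; [exact: NW|apply: Kmono Kk; rewrite leqW// leq_maxl].
have [|y [Ay Uy]] := Ax [set y : prod_topology X | forall i, (\bigcup_n F n i) (y i)].
  apply: (@nbhs_box I X x (fun i => \bigcup_n F n i)) => i.
  apply: open_nbhs_nbhs; split; first exact: Uopen.
  by exists 0.
have /choice : forall i, exists n, F n i (y i) by move=> i; have [n _ Fn] := Uy i; exists n.
case=> f fP.
have [_ _] := FI (\max_i f i); apply; exists y => // i.
by apply: Fmono (fP i); exact: leq_bigmax.
Qed.
End FiniteProduct.

(** * Countable Frechet groups *)

Section FrechetGroup.
Variable G : topologicalGroupType.
Hypotheses (Greg : t1_completely_regular G) (Gcount : countable [set: G]).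
Hypothesis Gfrechet : frechet_space G.
Hypothesis nondiscrete : closure (~` [set 1%g]) (1%g : G).
Local Open Scope group_scope.

Let acc : accessible_space G := Greg.1.

Lemma not_isolated (x : G) U : nbhs x U -> exists2 y, U y & y <> x.
Proof.
move=> Ux; have [|y [y1 Uy]] := nondiscrete (B := fun y => U (x * y)).
  by apply: nbhs_mull; rewrite mulg1.
by exists (x * y) => // E; apply: y1; apply: (@mulgI _ x); rewrite mulg1.
Qed.

Lemma unbounded_of_not_often (nu : nat -> nat) :
  (forall n, ~ often (fun i => nu i = n)) ->
  forall N, exists M, forall k, M <= k -> N <= nu k.
Proof.
move=> nn N; have [M MP] : exists M, forall k, M <= k -> ~ (`I_N \o nu) k.
  by apply: not_often => /(often_finite (finite_II N))[n _ /nn].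
by exists M => k /MP /negP; rewrite -leqNgt.
Qed.

(** Each [A n] is shifted by [c n], with [c n] tending to 1, and confined to a [V n] whose closure
    misses [x]. A sequence of shifted points converging to [x] then uses each [n] only finitely
    often, and dividing by [c n] undoes the shift. *)
Lemma strong_frechet (A : nat -> set G) x :
  (forall n, closure (A n) x) -> exists u nu, [/\ forall i, A (nu i) (u i),
    forall N, exists M, forall k, M <= k -> N <= nu k & tends u x].
Proof.
move=> Ax; have [c [cN1 /tendsP c1]] := Gfrechet nondiscrete.
have /choice[V VP] : forall n, exists V, [/\ open V, V (c n * x) & ~ closure V x].
  move=> n; have [|V [oV Vc Vx]] := @separate _ Greg x (c n * x).
    by move=> E; apply: (cN1 n); apply: (@mulIg _ x); rewrite -E mul1g.
  by exists V; split => // /(_ _ Vx)[y []].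
pose B := [set w | exists n y, [/\ A n y, V n (c n * y) & w = c n * y]].
have Bx : closure B x.
  have cx : tends (fun n => c n * x) x.
    by have := tends_mul c1 (@tends_cst _ x); rewrite mul1g.
  apply: closed_closure; apply: (tends_closure cx) => n U Ucx.
  have [oV Vc _] := VP n.
  have UVcx : nbhs (c n * x) (U `&` V n).
    by apply: filterI => //; exact: open_nbhs_nbhs.
  have [y [Ay [Uy Vy]]] := Ax n _ (nbhs_mull UVcx).
  by exists (c n * y); split=> //; exists n, y.
have [w [wB /tendsP wx]] := Gfrechet Bx.
have /choice[ny nyP] : forall i, exists ny : nat * G,
    [/\ A ny.1 ny.2, V ny.1 (c ny.1 * ny.2) & w i = c ny.1 * ny.2].
  by move=> i; have [n [y ?]] := wB i; exists (n, y).
have nuinf := @unbounded_of_not_often (fun i => (ny i).1).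
have {}nuinf : forall N, exists M, forall k, M <= k -> N <= (ny k).1.
  apply: nuinf => n oi; have [_ _] := VP n; apply.
  apply: (tends_often_closure wx); apply: sub_often oi => i nin /=.
  by have [_ + ->] := nyP i; rewrite nin.
exists (fun i => (ny i).2), (fun i => (ny i).1); split=> //.
  by move=> i; have [] := nyP i.
have := tends_mul (tends_inv (tends_unbounded nuinf c1)) wx.
rewrite invg1 mul1g; congr (tends _ x); apply/funext => i /=.
by have [_ _ ->] := nyP i; rewrite mulKg.
Qed.

(** A dense [Y] contains a nontrivial sequence converging to 1; any set hitting it infinitely often
    has 1 in its closure. *)
Lemma frechet_groomed : groomed G.
Proof.
move=> [Y [Yd Yent]].
have Y1 : closure (Y `\ 1) 1.
  move=> U U1; have [y Uy y1] := @not_isolated 1 U° (nbhs_interior U1).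
  have [||z [[Uz z1] Yz]] := Yd (U° `&` ~` [set 1]).
  - by exists y.
  - apply: openI; first exact: open_interior.
    exact/closed_openC/accessible_closed_set1.
  by exists z; split=> //; exact: interior_subset.
have [u [uY /tendsP u1]] := Gfrechet Y1.
have [Cinf C1] : seq_converges_to (range u) 1.
  by apply: tends_seq_conv => // n; have [] := uY n.
have [|A [AY nA] /(_ _ erefl) uA] := Yent 1 [set range u] (countable1 _).
  by move=> _ ->; split=> // _ [n _ <-]; have [] := uY n.
apply: nA; apply: (tends_often_closure u1); exact: infinite_range_often.
Qed.

Definition nowhere_dense (A : set G) := forall O, open O -> O !=set0 ->
  exists O', [/\ open O', O' !=set0, O' `<=` O & forall x, O' x -> ~ A x].

Lemma nowhere_dense_sub (A B : set G) :
  A `<=` B -> nowhere_dense B -> nowhere_dense A.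
Proof.
move=> AB nB O oO O0; have [O' [oO' O'0 O'O O'B]] := nB O oO O0.
by exists O'; split=> // x /O'B nBx /AB.
Qed.

Lemma nowhere_denseU (A B : set G) :
  nowhere_dense A -> nowhere_dense B -> nowhere_dense (A `|` B).
Proof.
move=> nA nB O oO O0; have [O1 [oO1 O10 O1O O1A]] := nA O oO O0.
have [O2 [oO2 O20 O2O1 O2B]] := nB O1 oO1 O10.
exists O2; split=> //; first exact: subset_trans O1O.
by move=> x O2x [/(O1A x (O2O1 x O2x))|/(O2B x O2x)].
Qed.

Lemma nowhere_dense1 (a : G) : nowhere_dense [set a].
Proof.
move=> O oO [x Ox]; have [y Oy yx] := not_isolated (open_nbhs_nbhs (conj oO Ox)).
exists (O `&` ~` [set a]); split=> //.
- by apply: openI => //; exact/closed_openC/accessible_closed_set1.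
- have [ya|ya] := pselect (y = a); last by exists y.
  by exists x; split=> // xa; apply: yx; rewrite ya.
- by move=> z [].
Qed.

Lemma nowhere_dense_finite (A : set G) : finite_set A -> nowhere_dense A.
Proof.
move=> /finite_seqP[s ->]; elim: s => [|a s IHs].
  by move=> O oO O0; exists O; split=> // x _; rewrite /= in_nil.
apply: nowhere_dense_sub (nowhere_denseU (nowhere_dense1 a) IHs) => x /=.
by rewrite inE => /orP[/eqP|]; [left|right].
Qed.

Lemma nowhere_dense_ideal : is_ideal nowhere_dense.
Proof.
split; [exact: nowhere_dense_sub|exact: nowhere_denseU|exact: nowhere_dense_finite].
Qed.

Lemma nowhere_dense_closure A : nowhere_dense A -> nowhere_dense (closure A).
Proof.
move=> nA O oO O0; have [O' [oO' O'0 O'O O'A]] := nA O oO O0.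
exists O'; split=> // x O'x /(_ O')[|y [/[swap]/O'A]//].
exact: open_nbhs_nbhs.
Qed.

Lemma nowhere_dense_homeo A (f g : G -> G) : continuous f -> continuous g ->
  cancel f g -> cancel g f -> nowhere_dense A -> nowhere_dense (fun x => A (f x)).
Proof.
move=> /continuousP fc /continuousP gc fK gK nA O oO [x Ox].
have [||O' [oO' [y O'y] O'O O'A]] := nA (g @^-1` O); first exact: gc.
  by exists (f x); rewrite /= fK.
exists (f @^-1` O'); split; first exact: fc.
- by exists (g y); rewrite /= gK.
- by move=> z /O'O; rewrite /= fK.
- by move=> z /O'A.
Qed.

Lemma nowhere_dense_invariant : invariant_ideal nowhere_dense.
Proof.
have mulrc g : continuous (fun x : G => x * g) by move=> x U; exact: nbhs_mulr.
have mullc g : continuous (fun x : G => g * x) by move=> x U; exact: nbhs_mull.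
apply: invariant_preimage => [A g|A g|A].
- by apply: (nowhere_dense_homeo (mullc g) (mullc g^-1)); [exact: mulKg|exact: mulVKg].
- by apply: (nowhere_dense_homeo (mulrc g) (mulrc g^-1)); [exact: mulgK|exact: mulgVK].
- by apply: (nowhere_dense_homeo (g := fun x => x^-1));
    [exact: invg_continuous|exact: invg_continuous|exact: invgK|exact: invgK].
Qed.

Lemma not_nowhere_dense A : ~ nowhere_dense A ->
  exists O, [/\ open O, O !=set0 & O `<=` closure A].
Proof.
move=> /existsNP[O /not_implyP[oO /not_implyP[O0 nO]]]; exists O; split=> //.
move=> x Ox U Ux; apply: contrapT => nAU; apply: nO.
exists (O `&` U°); split.
- by apply: openI => //; exact: open_interior.
- by exists x.
- by move=> y [].
- by move=> y [_ /interior_subset Uy] Ay; apply: nAU; exists y.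
Qed.

Lemma closure_nowhere_dense A B O x : open O -> O x -> O `<=` closure A ->
  nowhere_dense B -> closure (A `\` B) x.
Proof.
move=> oO Ox OA nB U Ux; have [||O' [oO' [y O'y] O'O O'B]] := nB (O `&` U°).
- by apply: openI => //; exact: open_interior.
- by exists x.
have [Oy _] := O'O y O'y.
have [|z [Az O'z]] := OA y Oy O'; first exact: open_nbhs_nbhs.
exists z; split; first by split=> //; exact: O'B.
by apply: interior_subset; have [] := O'O z O'z.
Qed.

(** [Y] is dense in some open [O]. If the preimages of sets of [J] were nowhere dense, each point of
    [O] would be the limit of a sequence of [Y] with unbounded [f]; a [B] hitting all these value
    sets would have a preimage dense in [O]. *)
Lemma nowhere_dense_tame : tame nowhere_dense.
Proof.
move=> Y /not_nowhere_dense[O [oO [x0 Ox0] OY]] f J Jid Jhit.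
apply: contrapT => nB.
have YB B : J B -> nowhere_dense (Y `&` f @^-1` B).
  by move=> JB; apply: contrapT => nd; apply: nB; exists B.
have [e eP] := group_enum Gcount.
have /choice[u uP] : forall x, exists u : nat -> G, O x ->
    [/\ forall i, Y (u i), infinite_set (range (f \o u)) & tends u x].
  move=> x; have [Ox|nOx] := pselect (O x); last by exists (fun=> x).
  have [|u [nu [uA nuinf ux]]] := @strong_frechet (fun n => Y `\` (Y `&` f @^-1` `I_n)) x.
    move=> n; apply: (closure_nowhere_dense oO Ox OY); apply: YB.
    by case: Jid => _ _; apply; exact: finite_II.
  exists u => _; split=> //; first by move=> i; have [] := uA i.
  apply/infinite_natP => N; have [M NM] := nuinf N.
  exists (f (u M)); last by exists M.
  have [Yu nYf] := uA M; rewrite leqNgt; apply/negP => fN; apply: nYf; split=> //=.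
  exact: leq_trans (NM M (leqnn M)).
have [||B JB BP] := Jhit ((fun n => range (f \o u (e n))) @` [set n | O (e n)]).
- exact: sub_countable (card_image_le _ _) (countableP _).
- by move=> _ [n On <-]; split=> //; have [] := uP (e n) On.
have [O' [oO' [x O'x] O'O O'B]] := YB B JB O oO (ex_intro _ x0 Ox0).
have [n en] := eP x; have Oen : O (e n) by rewrite en; exact: O'O.
have [Yu _ ux] := uP _ Oen.
have : closure (Y `&` f @^-1` B) (e n).
  apply: (tends_often_closure ux).
  have : often (B \o (f \o u (e n))) by apply: infinite_range_often; apply: BP; exists n.
  by apply: sub_often => k Bk; split=> //; exact: Yu.
rewrite en => /(_ O')[|y [yB O'y]]; first exact: open_nbhs_nbhs.
exact: O'B yB.
Qed.

Lemma countable_nbhs_base : IIA -> exists B : nat -> set G,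
  (forall n, nbhs 1 (B n)) /\ forall U, nbhs 1 U -> exists n, B n `<=` U.
Proof.
move=> iia; have [[N [Nnd Nmono Ncap]]|[H [Hnd HU]]] := IIA_closure iia Greg Gcount
  frechet_groomed nowhere_dense_ideal nowhere_dense_tame nowhere_dense_closure
  nowhere_dense_invariant.
  have [|u [nu [uA nuinf u1]]] := @strong_frechet (fun n => ~` (N n `|` [set 1])) 1.
    move=> n U /nbhs_interior U1.
    have [||O' [oO' [y O'y] O'U O'N]] := nowhere_denseU (Nnd n) (nowhere_dense1 1) (O := U°).
    - exact: open_interior.
    - by exists 1; exact: interior_subset.
    by exists y; split; [exact: O'N|apply: interior_subset; exact: O'U].
  have [|m om] := Ncap u 1 u1; first by move=> n un; apply: (uA n); right.
  have [M MP] := nuinf m; have [n Mn Nn] := om M.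
  by exfalso; apply: (uA n); left; exact: Nmono (MP n Mn) _ Nn.
(* If [H n] is contained in [V] up to a nowhere dense set, then [O n] lies in [closure V], so the
   quotients of points of [O n] form a small neighbourhood of 1. *)
have /choice[O OP] : forall n, exists O, [/\ open O, O !=set0 & O `<=` closure (H n)].
  by move=> n; exact: not_nowhere_dense.
exists (fun n => [set x^-1 * y | x in O n & y in O n]); split=> [n|U U1].
  have [oO [a Oa] _] := OP n.
  have : nbhs 1 (fun y => O n (a * y)).
    by apply: nbhs_mull; rewrite mulg1; exact: open_nbhs_nbhs.
  by apply: filterS => y Oay; exists a => //; exists (a * y); rewrite ?mulKg.
have [V [oV V1 Vs VU]] := nbhs1_symm U1 Greg.
have [|n HV] := HU V oV; first by exists 1.
exists n => _ [x Ox [y Oy <-]]; have [oO _ OH] := OP n.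
by apply: VU; apply: closure_subset (closure_nowhere_dense oO _ OH HV) => // z [Hz nHVz];
  apply: contrapT => nVz; apply: nHVz.
Qed.

End FrechetGroup.

(** * Dense subgroups and countable products *)

Section Subgroup.
Variables (G : topologicalGroupType) (W : set G).
Local Open Scope group_scope.

Definition divl_closed := W 1 /\ forall x y : G, W x -> W y -> W (x^-1 * y).

(* The proof of closure is a parameter of the type, so that the group
   structure can be inferred from the type alone. *)
Definition subgroup_of (h : divl_closed) : Type := {x : G | `[< W x >]}.

Variable h : divl_closed.
Local Notation H := (subgroup_of h).

Definition subgroup_val (x : H) : G := sval x.

Lemma subgroup_valP (x : H) : W (subgroup_val x).
Proof. exact/asboolP/(valP x). Qed.

Lemma subgroup_val_inj : injective subgroup_val.
Proof. exact: val_inj. Qed.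

Lemma divl_closedV x : W x -> W x^-1.
Proof. by case: h => W1 WV Wx; rewrite -[x^-1]mulg1; exact: WV. Qed.

Lemma divl_closedM x y : W x -> W y -> W (x * y).
Proof.
by case: h => W1 WV Wx Wy; rewrite -[x]invgK; apply: WV => //; exact: divl_closedV.
Qed.

Definition subgroup_mk x (Wx : W x) : H := exist _ x (asboolT Wx).

Definition subgroup_one : H := subgroup_mk h.1.
Definition subgroup_inv (x : H) : H := subgroup_mk (divl_closedV (subgroup_valP x)).
Definition subgroup_mul (x y : H) : H :=
  subgroup_mk (divl_closedM (subgroup_valP x) (subgroup_valP y)).

HB.instance Definition _ := Choice.copy H {x : G | `[< W x >]}.

Lemma subgroup_mulA : associative subgroup_mul.
Proof. by move=> x y z; apply: subgroup_val_inj; exact: mulgA. Qed.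
Lemma subgroup_mul1 : left_id subgroup_one subgroup_mul.
Proof. by move=> x; apply: subgroup_val_inj; exact: mul1g. Qed.
Lemma subgroup_mulr1 : right_id subgroup_one subgroup_mul.
Proof. by move=> x; apply: subgroup_val_inj; exact: mulg1. Qed.
Lemma subgroup_mulV : left_inverse subgroup_one subgroup_inv subgroup_mul.
Proof. by move=> x; apply: subgroup_val_inj; exact: mulVg. Qed.
Lemma subgroup_mulrV : right_inverse subgroup_one subgroup_inv subgroup_mul.
Proof. by move=> x; apply: subgroup_val_inj; exact: mulgV. Qed.

HB.instance Definition _ := isGroup.Build H subgroup_mulA subgroup_mul1
  subgroup_mulr1 subgroup_mulV subgroup_mulrV.

HB.instance Definition _ := Topological.copy H (initial_topology subgroup_val).

Lemma nbhs_subgroup (x : H) (U : set H) :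
  nbhs x U <-> exists2 O, nbhs (subgroup_val x) O & subgroup_val @^-1` O `<=` U.
Proof.
split=> [[_ [[O oO <-] Ox OU]]|[O]].
  by exists O => //; exact: open_nbhs_nbhs.
rewrite nbhsE => -[O' [oO' O'x] O'O] OU.
exists (subgroup_val @^-1` O'); split=> //; first by exists O'.
by move=> y /O'O; exact: OU.
Qed.

Lemma subgroup_mul_continuous : continuous (fun p : H * H => (p.1 * p.2)%g).
Proof.
move=> [x y] U /nbhs_subgroup[O /nbhs_mul[A [B [Ax By AB]]] OU].
exists (subgroup_val @^-1` A, subgroup_val @^-1` B) => /=.
  by split; apply/nbhs_subgroup; [exists A|exists B].
by move=> [a b] [/= Aa Bb]; apply: (OU (a * b)); exact: AB.
Qed.

Lemma subgroup_inv_continuous : continuous (fun x : H => (x^-1)%g).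
Proof.
move=> x U /nbhs_subgroup[O /nbhs_inv Ox OU].
by apply/nbhs_subgroup; exists (fun y => O y^-1) => // y; exact: (OU y^-1).
Qed.

HB.instance Definition _ := PreTopologicalGroup_isTopologicalGroup.Build H
  subgroup_mul_continuous subgroup_inv_continuous.

(** A closed set of the subgroup is the trace of a closed set of [G], and the uniformity separating
    a point from the latter is pulled back along the inclusion. *)
Lemma subgroup_t1_completely_regular :
  t1_completely_regular G -> t1_completely_regular H.
Proof.
move=> [acc creg]; split=> [x y /eqP xy|x B Bcl nBx].
  have /acc[U [oU]] : subgroup_val x != subgroup_val y.
    by apply/eqP => /subgroup_val_inj.
  rewrite !inE => Ux nUy; exists (subgroup_val @^-1` U); rewrite !inE; split=> //.
  by exists U.
have [O oO OE] : open (~` B) by exact: closed_openC.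
have [] := creg (subgroup_val x) (~` O); first exact: open_closedC.
  by apply; rewrite -[O _]/((subgroup_val @^-1` O) x) OE.
move=> uT [E /= [Eent ExO sub]].
pose UT := Uniform.Pack uT; pose f : H -> UT := subgroup_val.
exists (Uniform.class (initial_topology f)).
exists ((fun p : H * H => (f p.1, f p.2)) @^-1` E) => /=; split.
- by exists E.
- apply/seteqP; split=> // -[y z] [[/= -> Bz] Eyz].
  suff : (([set subgroup_val x] `*` ~` O) `&` E) (subgroup_val x, subgroup_val z).
    by rewrite ExO.
  split=> //; split=> //= Oz.
  by have : (subgroup_val @^-1` O) z by []; rewrite OE; exact.
- move=> y U [_ [[V oV <-] Vy VU]]; apply/nbhs_subgroup; exists V => //.
  by apply: sub; rewrite (@nbhsE UT); exists V.
Qed.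

Lemma subgroup_frechet : frechet_space G -> frechet_space H.
Proof.
move=> Gf A x Ax; have [|u [uA /tendsP ux]] := Gf (subgroup_val @` A) (subgroup_val x).
  move=> O Ox; have [|y [Ay Oy]] := Ax (subgroup_val @^-1` O).
    by apply/nbhs_subgroup; exists O.
  by exists (subgroup_val y); split=> //; exists y.
have /choice[v vP] : forall n, exists y, A y /\ subgroup_val y = u n.
  by move=> n; have [y Ay yu] := uA n; exists y.
exists v; split=> [n|]; first by have [] := vP n.
apply/tendsP => U /nbhs_subgroup[O /ux[N NO] OU]; exists N => n /NO On.
by apply: OU; rewrite /= (vP n).2.
Qed.

Lemma subgroup_countable : countable W -> countable [set: H].
Proof.
move=> /countable_injP[f finj]; apply/countable_injP.
exists (f \o subgroup_val) => x y _ _ /= fxy; apply: subgroup_val_inj.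
by apply: finj => //; rewrite inE; exact: subgroup_valP.
Qed.

End Subgroup.

Section FirstCountable.
Variable G : topologicalGroupType.
Hypothesis Greg : t1_completely_regular G.
Local Open Scope group_scope.

Lemma countable_dense_subgroup : separable_space G ->
  exists W : set G, [/\ divl_closed W, countable W & dense W].
Proof.
move=> [D [Dc Dd]].
pose Wn := fix Wn n := if n is m.+1 then [set x^-1 * y | x in Wn m & y in Wn m]
  else D `|` [set 1].
have Wn1 n : Wn n 1.
  by elim: n => [|n IHn] /=; [right|exists 1 => //; exists 1; rewrite // mulVg].
have WnS m n : m <= n -> Wn m `<=` Wn n.
  move=> /subnK <-; elim: (n - m) => [|k IHk] // x /IHk xk /=.
  by exists 1 => //; exists x; rewrite // invg1 mul1g.
exists (\bigcup_n Wn n); split.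
- split; first by exists 0%N.
  move=> x y [m _ Wx] [n _ Wy]; exists (maxn m n).+1 => //.
  exists x; first exact: WnS (leq_maxl _ _) _ Wx.
  by exists y; first exact: WnS (leq_maxr _ _) _ Wy.
- apply: bigcup_countable => // n _; elim: n => [|n IHn] /=.
    by rewrite -bigcup2E; apply: bigcup_countable => // -[|[|i]] _ //=.
  apply: (@sub_countable _ _ _ (Wn n `*` Wn n)); last exact: countableX.
  rewrite (_ : [set _ | _ in _ & _ in _] = (fun p => p.1^-1 * p.2) @` (Wn n `*` Wn n)).
    exact: card_image_le.
  apply/seteqP; split=> [_ [x Wx [y Wy <-]]|_ [[x y] [Wx Wy] <-]].
    by exists (x, y).
  by exists x => //; exists y.
- move=> O O0 oO; have [x [Ox Dx]] := Dd O O0 oO.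
  by exists x; split=> //; exists 0%N => //; left.
Qed.

Lemma separable_frechet_base : IIA -> separable_space G -> frechet_space G ->
  exists B : nat -> set G, (forall n, nbhs 1 (B n)) /\
    forall U, nbhs 1 U -> exists n, B n `<=` U.
Proof.
move=> iia Gsep Gf; have [W [Wg Wc Wd]] := countable_dense_subgroup Gsep.
pose H : topologicalGroupType := subgroup_of Wg.
have [B [B1 BU]] : exists B : nat -> set H, (forall n, nbhs 1 (B n)) /\
    forall U, nbhs 1 U -> exists n, B n `<=` U.
  have [nd|d] := pselect (closure (~` [set 1 : H]) (1 : H)).
    apply: (countable_nbhs_base (subgroup_t1_completely_regular Wg Greg)) => //.
      exact: subgroup_countable.
    exact: subgroup_frechet.
  exists (fun=> [set 1]); split=> [_|U U1]; last first.
    by exists 0%N => _ ->; exact: nbhs_singleton.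
  apply: contrapT => n1; apply: d => U U1; apply: contrapT => nU; apply: n1.
  apply: (filterS _ U1) => x Ux; apply: contrapT => x1.
  by apply: nU; exists x.
pose val := @subgroup_val G W Wg.
(* By density of [W], the closure of the trace of an open set contains that set, so these closures
   are neighbourhoods; regularity makes them small. *)
exists (fun n => closure (val @` B n)); split=> [n|U U1].
  have /nbhs_subgroup[O O1 OB] := B1 n.
  apply: (@filterS _ _ _ O°); last exact: nbhs_interior.
  move=> x Ox V /nbhs_interior Vx.
  have [||y [[Oy Vy] Wy]] := Wd (O° `&` V°).
  - by exists x; split => //; exact: nbhs_singleton.
  - by apply: openI; exact: open_interior.
  exists y; split; last exact: interior_subset.
  exists (subgroup_mk Wg Wy) => //; apply: OB; exact: (interior_subset Oy).
have [V [oV V1 VU]] := closed_nbhs Greg U1.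
have [|n BV] := BU (val @^-1` V).
  by apply/nbhs_subgroup; exists V => //; exact: open_nbhs_nbhs.
exists n; apply: subset_trans VU; apply: closure_subset => _ [y By <-]; exact: BV.
Qed.

Lemma decreasing_base (B : nat -> set G) :
  (forall n, nbhs (1 : G) (B n)) ->
  (forall U, nbhs (1 : G) U -> exists n, B n `<=` U) ->
  forall x : G, exists C : nat -> set G, [/\ forall n, nbhs x (C n),
    forall m n, m <= n -> C n `<=` C m & forall U, nbhs x U -> exists n, C n `<=` U].
Proof.
move=> B1 BU x; exists (fun n y => forall i : 'I_n.+1, B i (y * x^-1)); split.
- move=> n; apply: filter_forall => i; apply: nbhs_mulr; rewrite mulgV; exact: B1.
- move=> m n mn y By i.
  exact: (By (widen_ord (mn : m.+1 <= n.+1) i)).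
- move=> U Ux; have [|n BnU] := BU (fun y => U (y * x)).
    by apply: nbhs_mulr; rewrite mul1g.
  by exists n => y /(_ ord_max)/BnU; rewrite mulgVK.
Qed.
End FirstCountable.

(** The [n]-th term is restricted only in the coordinates with code below [n], a basic
    neighbourhood; each coordinate is restricted from some term on. *)
Lemma countable_product_frechet (I : countType) (X : I -> topologicalType) :
  (forall i (x : X i), exists C : nat -> set (X i), [/\ forall n, nbhs x (C n),
    forall m n, m <= n -> C n `<=` C m & forall U, nbhs x U -> exists n, C n `<=` U]) ->
  frechet_space (prod_topology X).
Proof.
move=> XC A x Ax.
pose C i := projT1 (cid (XC i (x i))).
have CP i : [/\ forall n, nbhs (x i) (C i n), forall m n, m <= n -> C i n `<=` C i m &
    forall U, nbhs (x i) U -> exists n, C i n `<=` U] := projT2 (cid (XC i (x i))).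
have /choice[u uP] : forall n, exists u, A u /\
    forall i, choice.pickle i < n -> C i n (u i).
  move=> n; pose f (j : 'I_n) : set (prod_topology X) :=
    if choice.unpickle j is Some i then [set y | C i n (y i)] else setT.
  have fx : nbhs x [set y | forall j, f j y].
    apply: (@filter_forall _ _ f (nbhs x)) => j; rewrite /f.
    case: choice.unpickle => [i|]; last exact: filterT.
    by apply: (@proj_continuous I X i x); have [] := CP i.
  have [y [Ay fy]] := Ax _ fx; exists y; split => // i il.
  by have := fy (Ordinal il); rewrite /f /= choice.pickleK.
exists u; split=> [n|]; first by have [] := uP n.
apply/tendsP/tends_prod => i U Ui; have [_ Cmono CU] := CP i.
have [n nU] := CU U Ui; exists (maxn n (choice.pickle i).+1) => k.
rewrite geq_max => /andP[nk ik]; apply: nU; apply: (Cmono n k nk).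
by have [_] := uP k; apply.
Qed.

Theorem corollary28 :
  IIA ->
  (forall (I : countType) (G : I -> topologicalGroupType),
     (forall i, [/\ t1_completely_regular (G i), separable_space (G i)
                  & frechet_space (G i)]) ->
     frechet_space (prod_topology G))
  /\
  (forall (I : finType) (G : I -> topologicalGroupType),
     (forall i, [/\ t1_completely_regular (G i), countable [set: G i]%classic,
                    sequential_space (G i)
                  & discrete_space (G i) \/ ~ frechet_space (G i)]) ->
     sequential_space (prod_topology G)).
Proof.
move=> iia; split=> I G GP.
  apply: countable_product_frechet => i x; have [Greg Gsep Gf] := GP i.
  have [B [B1 BU]] := separable_frechet_base Greg iia Gsep Gf.
  exact: decreasing_base BU x.
apply: finite_product_sequential => i; have [Greg Gc Gseq dnf] := GP i => //.
have [d|nd] := pselect (discrete_space (G i)); first exact: discrete_compact_capture.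
by case: dnf => // nF; exact: nondiscrete_compact_capture.
Qed.
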